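(* For $g\in A(\mathbb{D})$, real numbers $A<B$ and $r\in(0,1)$, set $$T_{A,B}(g)(r)=\int_{A}^{B}\log^+|g'(re^{i\theta})|\,d\theta .$$ Then the set $$R=\{f\in A(\mathbb{D}) : T_{A,B}(f) \text{ is unbounded on } (0,1) \text{ for all } A,B\in\mathbb{R} \text{ with } A<B\}$$ is a dense $G_\delta$ subset of $A(\mathbb{D})$. In particular, $R\neq\emptyset$, and the generic function $f$ in $A(\mathbb{D})$ (i.e. every $f$ in some dense $G_\delta$ subset of $A(\mathbb{D})$) satisfies $$\sup_{0<r<1}\int_{A}^{B}\log^+|f'(re^{i\theta})|\,d\theta=+\infty\quad\text{for all } A,B\in\mathbb{R}\text{ with } A<B .$$
   Context: $\mathbb{D}=\{z\in\mathbb{C}:|z|<1\}$ is the open unit disk. The disk algebra $A(\mathbb{D})$ is the set of functions $f:\overline{\mathbb{D}}\to\mathbb{C}$ that are continuous on $\overline{\mathbb{D}}$ and holomorphic on $\mathbb{D}$, endowed with the uniform (supremum) norm, for which it is a Banach space. For $f\in A(\mathbb{D})$, $f'$ denotes the complex derivative of $f$ on $\mathbb{D}$. The function $\log^+$ is defined by $\log^+t=\max\{0,\log t\}$ for $t>0$ and $\log^+t=0$ for $t\le 0$. *)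

(* Defs.v *)
From HB Require Import structures.
From mathcomp Require Import all_boot all_order all_algebra.
From mathcomp Require Import all_classical all_reals all_analysis.
From mathcomp Require Import complex.

Set Implicit Arguments.
Unset Strict Implicit.
Unset Printing Implicit Defensive.

Import Order.TTheory GRing.Theory Num.Theory.
Import numFieldNormedType.Exports.
Import ComplexField.

Local Open Scope ring_scope.
Local Open Scope complex_scope.
Local Open Scope classical_set_scope.

(* [R[i]] as a normed space over itself, hence [derivable] and [derive1] below
   are complex differentiability and the complex derivative. *)
HB.instance Definition _ (R : realType) := NormedModule.copy R[i] R[i]^o.

Definition closed_disk (R : realType) : set R[i] := [set z | `|z| <= 1].
Definition open_disk (R : realType) : set R[i] := [set z | `|z| < 1].

(* A function on the closed disk is represented by its extension by 0 to the
   whole plane; the last clause makes this representative unique. *)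
Definition is_disk_algebra (R : realType) : pred (R[i] -> R[i]) := fun f =>
  `[< [/\ {within @closed_disk R, continuous f},
          forall z, open_disk z -> derivable f z 1
        & forall z, ~ closed_disk z -> f z = 0] >].

Record disk_algebra (R : realType) := DiskAlgebra {
  disk_fun :> R[i] -> R[i];
  disk_funP : is_disk_algebra disk_fun }.

HB.instance Definition _ (R : realType) := [isSub for @disk_fun R].
HB.instance Definition _ (R : realType) := [Choice of disk_algebra R by <:].

Lemma is_disk_algebra_submod (R : realType) :
  submod_closed (@is_disk_algebra R).
Proof.
split=> [|a f g /asboolP[cf df f0] /asboolP[cg dg g0]]; apply/asboolP; split.
- by move=> x; exact: cvg_cst.
- by move=> z _; exact: derivable_cst.
- by [].
- move=> x; apply: cvgD; last exact: cg.
  by apply: cvgZl_tmp; exact: cf.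
- by move=> z Dz; apply: derivableD; [apply: derivableZ; exact: df|exact: dg].
- by move=> z Dz; rewrite /GRing.add/= /GRing.scale/= f0// g0// scaler0 addr0.
Qed.

HB.instance Definition _ (R : realType) :=
  GRing.isSubmodClosed.Build R[i] (R[i] -> R[i]) (@is_disk_algebra R)
    (@is_disk_algebra_submod R).
HB.instance Definition _ (R : realType) :=
  [SubChoice_isSubLmodule of disk_algebra R by <:].

(* The real-valued modulus; [`|z|] is the same number seen in [R[i]]. *)
Definition cmod (R : realType) (z : R[i]) : R := Normc.normc z.

Lemma cmodE (R : realType) (z : R[i]) : `|z| = (cmod z)%:C.
Proof. by []. Qed.

Lemma cmod_ge0 (R : realType) (z : R[i]) : 0 <= cmod z.
Proof. by rewrite -lecR -cmodE; exact: normr_ge0. Qed.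

Lemma cmodD (R : realType) (z w : R[i]) : cmod (z + w) <= cmod z + cmod w.
Proof. by rewrite -lecR rmorphD -!cmodE ler_normD. Qed.

Lemma cmodM (R : realType) (z w : R[i]) : cmod (z * w) = cmod z * cmod w.
Proof. exact: Normc.normcM. Qed.

Lemma cmod0 (R : realType) : cmod (0 : R[i]) = 0.
Proof. exact: Normc.normc0. Qed.

Lemma cmod_continuous (R : realType) : continuous (@cmod R).
Proof.
move=> z; apply/(@cvgrPdist_lt _ _ _ (nbhs z)) => e e0.
have /cvgrPdist_lt/(_ e%:C) zz : (w : R[i]) @[w --> z] --> z by exact: cvg_id.
near=> w.
have : `|z - w| < e%:C by near: w; apply: zz; rewrite ltcR.
rewrite cmodE ltcR; apply: le_lt_trans.
have cmodB (x y : R[i]) : cmod x - cmod y <= cmod (x - y).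
  by rewrite lerBlDr -{1}(subrK y x) cmodD.
rewrite ler_norml lerNl opprB cmodB andbT (le_trans (cmodB _ _))//.
by rewrite -lecR -!cmodE distrC.
Unshelve. all: by end_near. Qed.

Lemma real_complex_continuous (R : realType) :
  continuous (fun x : R => x%:C : R[i]).
Proof.
move=> x; apply/cvgrPdist_lt => -[e e'].
rewrite ltcE/= => /andP[/eqP-> e0].
near=> y.
rewrite -rmorphB/= cmodE /cmod/Normc.normc/= expr0n/= addr0 sqrtr_sqr ltcR.
near: y; apply: cvgr_dist_lt => //.
Unshelve. all: by end_near. Qed.

Lemma compact_closed_disk (R : realType) : compact (@closed_disk R).
Proof.
pose h (p : R * R) : R[i] := p.1%:C + 'i * p.2%:C.
have ch : continuous h.
  move=> p; apply: cvgD.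
    by apply: cvg_comp; [exact: cvg_fst|exact: real_complex_continuous].
  apply: cvgMl_tmp.
  by apply: cvg_comp; [exact: cvg_snd|exact: real_complex_continuous].
have hE x y : h (x, y) = x +i* y.
  by rewrite /h/=; simpc.
have cK : compact (h @` (`[(-1 : R), 1] `*` `[(-1 : R), 1])).
  apply: continuous_compact; first exact: continuous_subspaceT.
  by apply: compact_setX; exact: segment_compact.
apply: (subclosed_compact _ cK).
  have -> : @closed_disk R = @cmod R @^-1` [set x | x <= 1].
    by apply/seteqP; split => z; rewrite /closed_disk/= cmodE lecR.
  apply: preimage_closed; last exact: closed_le.
  by move=> x _; exact: cmod_continuous.
move=> [x y]; rewrite /closed_disk/= cmodE lecR /= => xy.
have xy1 : x ^+ 2 + y ^+ 2 <= 1.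
  by rewrite -[leLHS]sqr_sqrtr ?addr_ge0 ?sqr_ge0// expr_le1.
have aux (a b : R) : a ^+ 2 + b ^+ 2 <= 1 -> a \in `[-1, 1]%R.
  move=> ab; rewrite in_itv/= -ler_norml -(@expr_le1 _ 2)//.
  by rewrite real_normK ?num_real// (le_trans _ ab)// lerDl sqr_ge0.
exists (x, y) => //; split => /=.
  exact: (aux x y).
by apply: (aux y x); rewrite addrC.
Qed.

Lemma disk_algebra_bounded (R : realType) (f : disk_algebra R) :
  has_sup [set cmod (f z) | z in @closed_disk R].
Proof.
have D0 : @closed_disk R 0 by rewrite /closed_disk/= normr0.
split; first by exists (cmod (f 0)), 0.
have /asboolP[cf _ _] := disk_funP f.
have [||c _ cM] := @compact_EVT_max _ _ (@cmod R \o f) (@closed_disk R) _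
    (@compact_closed_disk R).
- by exists 0.
- move=> x; apply: (continuous_comp (cf x)); exact: cmod_continuous.
by exists (cmod (f c)) => _ [z Dz <-]; apply: cM; rewrite inE.
Qed.

Definition disk_norm (R : realType) (f : disk_algebra R) : R :=
  sup [set cmod (f z) | z in @closed_disk R].

Lemma disk_norm_ub (R : realType) (f : disk_algebra R) z :
  closed_disk z -> cmod (f z) <= disk_norm f.
Proof.
by move=> Dz; apply: sup_ubound; [case: (disk_algebra_bounded f)|exists z].
Qed.

Lemma disk_norm_le (R : realType) (f : disk_algebra R) (M : R) :
  (forall z, closed_disk z -> cmod (f z) <= M) -> disk_norm f <= M.
Proof.
move=> fM; apply: ge_sup; first by case: (disk_algebra_bounded f).
by move=> _ [z Dz <-]; exact: fM.
Qed.

Section disk_normed.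
Context {R : realType}.
Implicit Types f g : disk_algebra R.

(* The norm of a complex normed module takes its values in [R[i]]. *)
Let norm f : R[i] := (disk_norm f)%:C.

Let ler_normD f g : norm (f + g) <= norm f + norm g.
Proof.
rewrite /norm -rmorphD lecR; apply: disk_norm_le => z Dz.
apply: (le_trans (cmodD _ _)).
by apply: lerD; exact: disk_norm_ub.
Qed.

Let disk_normZ_le (l : R[i]) f :
  disk_norm (l *: f) <= cmod l * disk_norm f.
Proof.
apply: disk_norm_le => z Dz.
rewrite [leLHS](_ : _ = cmod l * cmod (f z)); last first.
  exact: cmodM.
apply: ler_wpM2l; first exact: cmod_ge0.
exact: disk_norm_ub.
Qed.

Let normrZ (l : R[i]) f : norm (l *: f) = `|l| * norm f.
Proof.
rewrite /norm cmodE -rmorphM; congr (_ %:C).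
apply/eqP; rewrite eq_le disk_normZ_le/=.
have [->|l0] := eqVneq l 0.
  rewrite cmod0 mul0r scale0r.
  have D0 : @closed_disk R 0 by rewrite /closed_disk/= normr0.
  by have := disk_norm_ub (0 : disk_algebra R) D0; rewrite cmod0.
have nl0 : 0 < cmod l by rewrite -ltcR -cmodE normr_gt0.
rewrite -ler_pdivlMl// -Normc.normcV -{1}(scale1r f) -(mulVf l0) -scalerA.
exact: disk_normZ_le.
Qed.

Let normr0_eq0 f : norm f = 0 -> f = 0.
Proof.
move=> /complexI nf0; apply: val_inj; apply/funext => z /=.
have /asboolP[_ _ f0] := disk_funP f.
have [Dz|nDz] := pselect (closed_disk z); last exact: f0.
apply: Normc.eq0_normc; apply/eqP; rewrite eq_le cmod_ge0 andbT.
by rewrite -[X in _ <= X]nf0; exact: disk_norm_ub.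
Qed.

HB.instance Definition _ :=
  Lmodule_isNormed.Build R[i] (disk_algebra R) ler_normD normrZ normr0_eq0.

End disk_normed.

Definition log_plus (R : realType) (t : R) : R :=
  if 0 < t then Num.max 0 (ln t) else 0.

(* For [r] in ]0, 1[ the integrand is continuous in [t], so the integral is
   finite and its real-valued version [Rintegral] loses nothing. *)
Definition log_plus_mean (R : realType) (A B : R) (g : disk_algebra R) (r : R)
    : R :=
  \int[lebesgue_measure]_(t in `[A, B])
    log_plus (cmod (derive1 g ((r * cos t) +i* (r * sin t)))).

Definition unbounded_means (R : realType) : set (disk_algebra R) :=
  [set f | forall A B : R, A < B ->
     ~ [bounded log_plus_mean A B f r | r in `]0, 1[]].

(* Main.v *)
Require Import Defs.
From HB Require Import structures.
From mathcomp Require Import all_boot all_order all_algebra.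
From mathcomp Require Import all_classical all_reals all_analysis.
From mathcomp Require Import borel_hierarchy complex.
From mathcomp Require Import ring lra zify.

(** Write T f r for the integral of log^+ |f'(r e^(it))| over t in [A, B].

    G-delta.  Cauchy's estimate |f'(z)| <= 4 ||f|| / (1 - |z|) and the fact
    that log^+ is 1-Lipschitz make f |-> T f r a Lipschitz function for fixed
    r < 1, so {f | T f r > m} is open.  Since T increases with the arc, only
    arcs with rational endpoints matter, and the set of the theorem is the
    countable intersection, over rational arcs and natural numbers m, of the
    open sets  \bigcup_(0 < r < 1) {f | T f r > m}  ([unbounded_meansE]).

    Nonemptiness.  The lacunary series  h(z) = \sum_k 2^-k z^(64^k)  converges
    uniformly on the closed disk, so h is in the algebra.  On the circle of
    radius r_k = 1 - 1 / (2 * 64^k) the k-th term of h', of modulus at least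
    32^k / 2, dominates the sum of all the others: the earlier ones add up to
    at most 32^k / 31 and the later ones to at most 32^k / 8.  Hence
    |h'| >= 32^k / 8 on the whole circle ([lac_limit_derive1_ge]) and every
    mean of h is unbounded.

    Density.  A dilation z |-> f(rho z) is uniformly close to f when rho is
    close to 1, and it has a bounded derivative.  Adding a small multiple of h
    to it gives a function whose derivative is again arbitrarily large on
    entire circles ([dense_unbounded_means]).

    The remaining ingredient is Cauchy's estimate for functions that are only
    assumed to be complex differentiable at each point.  In polar coordinates
    z = e^s e^(it) a circular annulus becomes a rectangle on two sides of which
    the function takes the same values, so Goursat's theorem for rectangles
    ([goursat], by repeated quartering) says that circle means do not depend
    on the radius ([circle_mean_const]).  Applied to the difference quotient
    w |-> (f(z0 + w) - f(z0)) / w, whose means tend to f'(z0) as the radius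
    tends to 0, this gives the estimate ([cauchy_estimate]). *)

Set Implicit Arguments.
Unset Strict Implicit.
Unset Printing Implicit Defensive.

Import Order.TTheory GRing.Theory Num.Theory.
Import numFieldNormedType.Exports.

Local Open Scope ring_scope.
Local Open Scope classical_set_scope.

(** * Integrals over a segment *)

Lemma geometric_small (R : realType) (K e : R) : 0 < e ->
  exists n, K / 2 ^+ n <= e.
Proof.
move=> e0; have K0 : 0 <= `|K| / e by rewrite divr_ge0// ltW.
exists (Num.bound (`|K| / e)); set n := Num.bound _.
have Kn : `|K| / e < 2 ^+ n.
  by apply: lt_trans (archi_boundP K0) _; rewrite -natrX ltr_nat ltn_expl.
rewrite ler_pdivrMr ?exprn_gt0//; apply: (le_trans (ler_norm K)).
by rewrite -ler_pdivrMl// mulrC ltW.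
Qed.

Section segment_integral.
Context {R : realType}.
Implicit Types (f g : R -> R) (a b m x k M : R).
Notation mu := (@lebesgue_measure R).

Definition segint f a b : R := \int[mu]_(x in `[a, b]) f x.

Lemma segment_integrable f a b :
  (forall x, a <= x <= b -> {for x, continuous f}) ->
  mu.-integrable `[a, b] (EFin \o f).
Proof.
move=> cf; apply: continuous_compact_integrable; first exact: segment_compact.
apply: continuous_in_subspaceT => x; rewrite inE/= in_itv/=; exact: cf.
Qed.

Lemma segint_cst k a b : a <= b -> segint (fun=> k) a b = k * (b - a).
Proof.
move=> ab; rewrite /segint Rintegral_cst//; congr (_ * _).
have := @lebesgue_measure_itv R (`[a, b])%R; rewrite /= lte_fin => ->.
case: ltP => [//|ba]/=.
by apply/esym/eqP; rewrite subr_eq0 eq_le ba ab.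
Qed.

Lemma le_segint f g a b :
  (forall x, a <= x <= b -> {for x, continuous f}) ->
  (forall x, a <= x <= b -> {for x, continuous g}) ->
  (forall x, a <= x <= b -> f x <= g x) -> segint f a b <= segint g a b.
Proof.
move=> cf cg fg; apply: le_Rintegral => //; try exact: segment_integrable.
Qed.

Lemma ler_segint_cst f M a b : a <= b ->
  (forall x, a <= x <= b -> {for x, continuous f}) ->
  (forall x, a <= x <= b -> f x <= M) -> segint f a b <= M * (b - a).
Proof.
move=> ab cf fM; rewrite -segint_cst//; apply: le_segint => // x _.
exact: cvg_cst.
Qed.

Lemma ger_segint_cst f M a b : a <= b ->
  (forall x, a <= x <= b -> {for x, continuous f}) ->
  (forall x, a <= x <= b -> M <= f x) -> M * (b - a) <= segint f a b.
Proof.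
move=> ab cf fM; rewrite -segint_cst//; apply: le_segint => // x _.
exact: cvg_cst.
Qed.

Lemma segint_dist f k M a b : a <= b ->
  (forall x, a <= x <= b -> {for x, continuous f}) ->
  (forall x, a <= x <= b -> `|f x - k| <= M) ->
  `|segint f a b - k * (b - a)| <= M * (b - a).
Proof.
move=> ab cf fM.
have f1 x : a <= x <= b -> f x <= k + M.
  by move=> /fM; rewrite ler_distl => /andP[].
have f2 x : a <= x <= b -> k - M <= f x.
  by move=> /fM; rewrite ler_distl => /andP[].
have := ler_segint_cst ab cf f1; have := ger_segint_cst ab cf f2.
by rewrite ler_distl mulrBl mulrDl => -> ->.
Qed.

Lemma segintB f g a b :
  (forall x, a <= x <= b -> {for x, continuous f}) ->
  (forall x, a <= x <= b -> {for x, continuous g}) ->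
  segint (fun x => f x - g x) a b = segint f a b - segint g a b.
Proof. by move=> cf cg; apply: RintegralB => //; exact: segment_integrable. Qed.

Lemma segint_split f a m b : a <= m -> m <= b ->
  (forall x, a <= x <= b -> {for x, continuous f}) ->
  segint f a b = segint f a m + segint f m b.
Proof.
move=> am mb cf; have := @Rintegral_itvB _ f (BLeft a) (BRight b) m.
have fi := segment_integrable cf.
rewrite !bnd_simp => /(_ fi am mb) H.
apply/eqP; rewrite addrC -subr_eq; apply/eqP; rewrite H.
apply: Rintegral_itv_obnd_cbnd; apply: integrableS fi => //.
by apply: subset_itvr; rewrite bnd_simp.
Qed.

End segment_integral.

(** * Goursat's theorem on a rectangle *)

Section goursat.
Context {R : realType}.
Variables U V : R -> R -> R.

(** That is, U + iV is complex differentiable at x + iy, with derivative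
    p + iq. *)
Definition cauchy_riemann_at x y := exists p q : R, forall e : R, 0 < e ->
  exists2 d : R, 0 < d & forall h k : R, `|h| <= d -> `|k| <= d ->
    `|U (x + h) (y + k) - U x y - (p * h - q * k)| <= e * (`|h| + `|k|) /\
    `|V (x + h) (y + k) - V x y - (q * h + p * k)| <= e * (`|h| + `|k|).

(** The imaginary part of the integral of U + iV along the boundary of
    [a, b] * [c, d], with opposite sides grouped in a single integral. *)
Definition circulation a b c d :=
  segint (fun x => V x c - V x d) a b + segint (fun y => U b y - U a y) c d.

Lemma linear_growth_continuous (f : R -> R) x (d l : R) : 0 < d ->
  (forall h, `|h| <= d -> `|f (x + h) - f x| <= l * `|h|) ->
  {for x, continuous f}.
Proof.
move=> d0 fd; apply/cvgrPdist_le => /= e e0.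
have M0 : 0 < `|l| + 1 by rewrite ltr_wpDl.
near=> z.
have zd : `|z - x| <= d by near: z; apply: cvgr_distC_le.
rewrite distrC -{1}(subrKC x z) (le_trans (fd _ zd))//.
apply: (@le_trans _ _ ((`|l| + 1) * `|z - x|)).
  by rewrite ler_wpM2r// (le_trans (ler_norm _))// lerDl.
rewrite -ler_pdivlMl//; near: z; apply: cvgr_distC_le => //.
by rewrite mulr_gt0// invr_gt0.
Unshelve. all: by end_near. Qed.

Lemma cauchy_riemann_continuous x y : cauchy_riemann_at x y ->
  [/\ {for x, continuous (U^~ y)}, {for x, continuous (V^~ y)},
      {for y, continuous (U x)} & {for y, continuous (V x)}].
Proof.
move=> [p [q /(_ 1 ltr01)[d d0 H]]].
have d0' : 0 <= d := ltW d0.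
have Hh h : `|h| <= d -> `|U (x + h) y - U x y - p * h| <= `|h| /\
   `|V (x + h) y - V x y - q * h| <= `|h|.
  move=> hd; have := H h 0 hd; rewrite normr0 addr0 !mulr0 subr0 !addr0 mul1r.
  exact.
have Hk k : `|k| <= d -> `|U x (y + k) - U x y - - (q * k)| <= `|k| /\
   `|V x (y + k) - V x y - p * k| <= `|k|.
  move=> kd; have := H 0 k; rewrite normr0 addr0 !mulr0 !add0r mul1r.
  exact.
have aux (a b t : R) : `|a - b * t| <= `|t| -> `|a| <= (1 + `|b|) * `|t|.
  move=> H1; have := ler_normD (a - b * t) (b * t).
  rewrite subrK normrM mulrDl mul1r => H2; lra.
split.
- apply: (@linear_growth_continuous _ _ d (1 + `|p|)) => // h /Hh[+ _].
  exact: aux.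
- apply: (@linear_growth_continuous _ _ d (1 + `|q|)) => // h /Hh[_ +].
  exact: aux.
- apply: (@linear_growth_continuous _ _ d (1 + `|- q|)) => // h /Hk[+ _].
  by rewrite -mulNr; exact: aux.
- apply: (@linear_growth_continuous _ _ d (1 + `|p|)) => // h /Hk[_ +].
  exact: aux.
Qed.

Variables a0 b0 c0 d0 : R.
Hypothesis UV_holo : forall x y, a0 <= x <= b0 -> c0 <= y <= d0 ->
  cauchy_riemann_at x y.

Let contV y x : c0 <= y <= d0 -> a0 <= x <= b0 -> {for x, continuous (V^~ y)}.
Proof.
by move=> yI xI; have [] := cauchy_riemann_continuous (UV_holo xI yI).
Qed.

Let contU x y : a0 <= x <= b0 -> c0 <= y <= d0 -> {for y, continuous (U x)}.
Proof.
by move=> xI yI; have [] := cauchy_riemann_continuous (UV_holo xI yI).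
Qed.

Lemma circulation_splitl a m b c d :
  a0 <= a -> a <= m -> m <= b -> b <= b0 -> c0 <= c -> c <= d -> d <= d0 ->
  circulation a b c d = circulation a m c d + circulation m b c d.
Proof.
move=> a0a am mb bb0 c0c cd dd0; rewrite /circulation.
rewrite (@segint_split _ _ a m b)//; last first.
  move=> x /andP[ax xb]; apply: cvgB; apply: contV; lra.
rewrite [in RHS]addrACA; congr (_ + _).
rewrite !segintB; first lra.
all: move=> x /andP[cx xd]; apply: contU; lra.
Qed.

Lemma circulation_splitr a b c m d :
  a0 <= a -> a <= b -> b <= b0 -> c0 <= c -> c <= m -> m <= d -> d <= d0 ->
  circulation a b c d = circulation a b c m + circulation a b m d.
Proof.
move=> a0a ab bb0 c0c cm md dd0; rewrite /circulation.
rewrite (@segint_split _ _ c m d)//; last first.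
  move=> x /andP[ax xb]; apply: cvgB; apply: contU; lra.
rewrite [in RHS]addrACA; congr (_ + _).
rewrite !segintB; first lra.
all: move=> x /andP[cx xd]; apply: contV; lra.
Qed.

(** Replace U and V by their affine approximations at (x, y): the integrands
    V(., c) - V(., d) and U(b, .) - U(a, .) become the constants p (c - d) and
    p (b - a), whose contributions to the circulation cancel. *)
Lemma circulation_small x y (e : R) : a0 <= x <= b0 -> c0 <= y <= d0 -> 0 < e ->
  exists2 r : R, 0 < r & forall a b c d,
    a0 <= a -> a <= x -> x <= b -> b <= b0 ->
    c0 <= c -> c <= y -> y <= d -> d <= d0 ->
    b - a <= r -> d - c <= r ->
    `|circulation a b c d| <= e * (b - a + (d - c)) ^+ 2.
Proof.
move=> xI yI e0; have [p [q H]] := UV_holo xI yI.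
have e20 : 0 < e / 2 by rewrite divr_gt0.
have {H} [r r0 H] := H _ e20; exists r => // a b c d.
move=> a0a ax xb bb0 c0c cy yd dd0 bar dcr.
set L := b - a + (d - c).
have HU z w : a <= z <= b -> c <= w <= d ->
    `|U z w - U x y - (p * (z - x) - q * (w - y))| <= e / 2 * L /\
    `|V z w - V x y - (q * (z - x) + p * (w - y))| <= e / 2 * L.
  move=> zI wI.
  have zx : `|z - x| <= b - a by rewrite ler_norml; lra.
  have wy : `|w - y| <= d - c by rewrite ler_norml; lra.
  have [] := H (z - x) (w - y) (le_trans zx bar) (le_trans wy dcr).
  rewrite !subrKC => H1 H2.
  have zwL : e / 2 * (`|z - x| + `|w - y|) <= e / 2 * L.
    by rewrite ler_pM2l// lerD.
  by split; [apply: le_trans H1 _|apply: le_trans H2 _].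
have I1 : `|segint (fun x => V x c - V x d) a b - p * (c - d) * (b - a)| <=
    e * L * (b - a).
  apply: segint_dist; first lra.
    by move=> z zI; apply: cvgB; apply: contV; lra.
  move=> z zI.
  have [|_ h1] := HU z c zI; first lra.
  have [|_ h2] := HU z d zI; first lra.
  move: h1 h2; rewrite !ler_norml => /andP[h1 h2] /andP[h3 h4].
  by apply/andP; split; lra.
have I2 : `|segint (fun y => U b y - U a y) c d - p * (b - a) * (d - c)| <=
    e * L * (d - c).
  apply: segint_dist; first lra.
    by move=> z zI; apply: cvgB; apply: contU; lra.
  move=> z zI.
  have [|h1 _] := HU b z _ zI; first lra.
  have [|h2 _] := HU a z _ zI; first lra.
  move: h1 h2; rewrite !ler_norml => /andP[h1 h2] /andP[h3 h4].
  by apply/andP; split; lra.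
rewrite /circulation; move: I1 I2; set S := segint _ _ _; set T := segint _ _ _.
move=> I1 I2; rewrite expr2 mulrA {2}/L mulrDr.
have -> : S + T = (S - p * (c - d) * (b - a)) + (T - p * (b - a) * (d - c)).
  by ring.
exact: le_trans (ler_normD _ _) (lerD I1 I2).
Qed.

Lemma circulation_quarter a b c d :
  a0 <= a -> a <= b -> b <= b0 -> c0 <= c -> c <= d -> d <= d0 ->
  exists2 s : R * R,
    (s.1 = a \/ s.1 = (a + b) / 2) /\ (s.2 = c \/ s.2 = (c + d) / 2) &
   `|circulation a b c d| <=
     4 * `|circulation s.1 (s.1 + (b - a) / 2) s.2 (s.2 + (d - c) / 2)|.
Proof.
move=> a0a ab bb0 c0c cd dd0.
set m := (a + b) / 2; set n := (c + d) / 2.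
have E : circulation a b c d =
    (circulation a m c n + circulation a m n d) +
    (circulation m b c n + circulation m b n d).
  rewrite (@circulation_splitl a m b c d) /m; try lra.
  by congr (_ + _); apply: circulation_splitr; rewrite /n; lra.
apply: contrapT => H.
have K s : (s.1 = a \/ s.1 = m) -> (s.2 = c \/ s.2 = n) ->
   4 * `|circulation s.1 (s.1 + (b - a) / 2) s.2 (s.2 + (d - c) / 2)| <
   `|circulation a b c d|.
  by move=> s1 s2; rewrite ltNge; apply/negP => Ks; apply: H; exists s.
have am : a + (b - a) / 2 = m by rewrite /m; lra.
have mb : m + (b - a) / 2 = b by rewrite /m; lra.
have cn : c + (d - c) / 2 = n by rewrite /n; lra.
have nd : n + (d - c) / 2 = d by rewrite /n; lra.
have /= := K (a, c) (or_introl erefl) (or_introl erefl).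
have /= := K (a, n) (or_introl erefl) (or_intror erefl).
have /= := K (m, c) (or_intror erefl) (or_introl erefl).
have /= := K (m, n) (or_intror erefl) (or_intror erefl).
rewrite am mb cn nd E => K1 K2 K3 K4.
have := ler_normD (circulation a m c n + circulation a m n d)
  (circulation m b c n + circulation m b n d).
have := ler_normD (circulation a m c n) (circulation a m n d).
have := ler_normD (circulation m b c n) (circulation m b n d).
lra.
Qed.

(** Quartering repeatedly gives nested rectangles, of sides w / 2^n and h / 2^n,
    that carry at least 1 / 4^n of the circulation.  They shrink to a point,
    near which the circulation is o(4^-n) by [circulation_small]. *)
Lemma goursat : a0 <= b0 -> c0 <= d0 -> circulation a0 b0 c0 d0 = 0.
Proof.
move=> ab cd.
set w := b0 - a0; set h := d0 - c0.
pose wn n : R := w / 2 ^+ n; pose hn n : R := h / 2 ^+ n.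
have w0 : 0 <= w by rewrite /w; lra.
have h0 : 0 <= h by rewrite /h; lra.
have wn0 n : 0 <= wn n by rewrite /wn divr_ge0// exprn_ge0.
have hn0 n : 0 <= hn n by rewrite /hn divr_ge0// exprn_ge0.
have wnS n : wn n = 2 * wn n.+1 by rewrite /wn exprS invfM; lra.
have hnS n : hn n = 2 * hn n.+1 by rewrite /hn exprS invfM; lra.
pose good n (s : R * R) :=
  [/\ a0 <= s.1, s.1 + wn n <= b0, c0 <= s.2, s.2 + hn n <= d0
   & `|circulation a0 b0 c0 d0| <=
     4 ^+ n * `|circulation s.1 (s.1 + wn n) s.2 (s.2 + hn n)|].
have step n s : good n s -> exists s', [/\ good n.+1 s', s.1 <= s'.1,
    s'.1 + wn n.+1 <= s.1 + wn n, s.2 <= s'.2 & s'.2 + hn n.+1 <= s.2 + hn n].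
  move=> [g1 g2 g3 g4 g5].
  have [||||||s' [s1 s2] H] :=
    @circulation_quarter s.1 (s.1 + wn n) s.2 (s.2 + hn n).
  - lra. - have := wn0 n; lra. - lra. - lra. - have := hn0 n; lra. - lra.
  have W : (s.1 + wn n - s.1) / 2 = wn n.+1 by rewrite wnS; lra.
  have Hh : (s.2 + hn n - s.2) / 2 = hn n.+1 by rewrite hnS; lra.
  have := wn0 n.+1; have := hn0 n.+1; have := wnS n; have := hnS n.
  move: H; rewrite W Hh => H x1 x2 x3 x4.
  exists s'; split; last 4 first.
  - lra. - lra. - lra. - lra.
  split; [lra|lra|lra|lra|].
  by apply: le_trans g5 _; rewrite exprSr -mulrA ler_pM2l// exprn_gt0.
have /choice [F HF] : forall ns : nat * (R * R), exists s', good ns.1 ns.2 ->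
   [/\ good ns.1.+1 s', ns.2.1 <= s'.1,
    s'.1 + wn ns.1.+1 <= ns.2.1 + wn ns.1, ns.2.2 <= s'.2
    & s'.2 + hn ns.1.+1 <= ns.2.2 + hn ns.1].
  move=> [n s]; have [/step[s' Hs']|ng] := pselect (good n s).
    by exists s'.
  by exists s => /ng.
pose u := fix u n := if n is m.+1 then F (m, u m) else (a0, c0).
have gu n : good n (u n).
  elim: n => [|n /(HF (n, _))[]//].
  rewrite /good /= /wn /hn !expr0 /w /h !divr1 mul1r !lexx !subrKC !lexx.
  by split.
have uS n := HF (n, u n) (gu n).
have mono n m : (n <= m)%N ->
  [/\ (u n).1 <= (u m).1, (u m).1 + wn m <= (u n).1 + wn n,
      (u n).2 <= (u m).2 & (u m).2 + hn m <= (u n).2 + hn n].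
  elim: m => [|m IH]; first by rewrite leqn0 => /eqP ->.
  rewrite leq_eqVlt => /orP[/eqP->//|]; rewrite ltnS => /IH[i1 i2 i3 i4].
  have [_ /= j1 j2 j3 j4] := uS m.
  by split; [lra|lra|lra|lra].
have cross n m : (u m).1 <= (u n).1 + wn n /\ (u m).2 <= (u n).2 + hn n.
  have := wn0 m; have := hn0 m; have := wn0 n; have := hn0 n.
  by case/orP: (leq_total n m) => /mono[]; split; lra.
(* The lower left corners increase to the common point of the rectangles. *)
pose x := sup (range (fun n => (u n).1)).
pose y := sup (range (fun n => (u n).2)).
have hx : has_sup (range (fun n => (u n).1)).
  split; first by exists (u 0%N).1, 0%N.
  by exists ((u 0%N).1 + wn 0%N) => _ [n _ <-]; case: (cross 0%N n).
have hy : has_sup (range (fun n => (u n).2)).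
  split; first by exists (u 0%N).2, 0%N.
  by exists ((u 0%N).2 + hn 0%N) => _ [n _ <-]; case: (cross 0%N n).
have xn n : (u n).1 <= x <= (u n).1 + wn n.
  apply/andP; split; first by apply: sup_ubound; [case: hx|exists n].
  by apply: ge_sup; [case: hx|move=> _ [m _ <-]; case: (cross n m)].
have yn n : (u n).2 <= y <= (u n).2 + hn n.
  apply/andP; split; first by apply: sup_ubound; [case: hy|exists n].
  by apply: ge_sup; [case: hy|move=> _ [m _ <-]; case: (cross n m)].
have xI : a0 <= x <= b0 by have := xn 0%N; have [] := gu 0%N; lra.
have yI : c0 <= y <= d0 by have := yn 0%N; have [] := gu 0%N; lra.
apply/eqP; rewrite -normr_eq0 eq_le normr_ge0 andbT.
suff S e : 0 < e -> `|circulation a0 b0 c0 d0| <= e * (w + h) ^+ 2.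
  apply/ler_addgt0Pl => e e0; rewrite addr0.
  have K0 : 0 < (w + h) ^+ 2 + 1 by rewrite ltr_wpDl// sqr_ge0.
  have eK : 0 < e / ((w + h) ^+ 2 + 1) by rewrite divr_gt0.
  apply: le_trans (S _ eK) _.
  by rewrite mulrAC ler_pdivrMr// ler_pM2l// lerDl.
move=> e0; have [r r0 H] := circulation_small xI yI e0.
have [n nr] := geometric_small (w + h) r0.
have whE : wn n + hn n = (w + h) / 2 ^+ n by rewrite /wn /hn -mulrDl.
have wr : wn n <= r by have := hn0 n; lra.
have hr : hn n <= r by have := wn0 n; lra.
have [g1 g2 g3 g4 g5] := gu n.
have := xn n; have := yn n => /andP[y1 y2] /andP[x1 x2].
apply: le_trans g5 _.
have := H _ _ _ _ g1 x1 x2 g2 g3 y1 y2 g4.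
rewrite !(addrC (_ n).1) !(addrC (_ n).2) !addrK => /(_ wr hr) K.
rewrite -ler_pdivlMl ?exprn_gt0//; apply: le_trans K _.
have two2 : 2 ^+ 2 = 4 :> R by rewrite expr2; lra.
rewrite whE expr_div_n -exprM mulnC exprM two2.
by rewrite [leRHS]mulrC mulrA.
Qed.

End goursat.

(** * Complex derivatives in epsilon-delta form *)

Section modulus.
Context {R : realType}.
Implicit Types (z w : R[i]).

Lemma complex_gt0 (e : R[i]) : 0 < e -> exists2 r : R, 0 < r & e = (r%:C)%C.
Proof.
case: e => a b; rewrite ltcE/= => /andP[/eqP-> a0].
by exists a.
Qed.

Lemma cmod_lt z (r : R) : (`|z| < (r%:C)%C) = (cmod z < r).
Proof. by rewrite cmodE ltcR. Qed.

Lemma cmod_le z (r : R) : (`|z| <= (r%:C)%C) = (cmod z <= r).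
Proof. by rewrite cmodE lecR. Qed.

Lemma cmod_eq0 z : (cmod z == 0) = (z == 0).
Proof. by apply/eqP/eqP => [/Normc.eq0_normc|->]//; rewrite cmod0. Qed.

Lemma cmod_gt0 z : (0 < cmod z) = (z != 0).
Proof. by rewrite lt0r cmod_eq0 cmod_ge0 andbT. Qed.

Lemma cmodN z : cmod (- z) = cmod z.
Proof. by case: z => a b; rewrite /cmod/Normc.normc/= !sqrrN. Qed.

Lemma cmodV z : cmod z^-1 = (cmod z)^-1.
Proof. exact: Normc.normcV. Qed.

Lemma cmodC (r : R) : cmod (r%:C)%C = `|r|.
Proof. by rewrite /cmod/Normc.normc/= expr0n/= addr0 sqrtr_sqr. Qed.

Lemma cmodCM (r : R) z : 0 < r -> cmod ((r%:C)%C * z) = r * cmod z.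
Proof. by move=> r0; rewrite cmodM cmodC gtr0_norm. Qed.

Lemma cmodJ z : cmod (z^*)%C = cmod z.
Proof. by case: z => a b; rewrite /cmod/= sqrrN. Qed.

Lemma cmodX z n : cmod (z ^+ n) = cmod z ^+ n.
Proof.
elim: n => [|n IH]; last by rewrite !exprS cmodM IH.
by rewrite !expr0 -[1]/(1%:C)%C cmodC normr1.
Qed.

Lemma cmod_distC z w : cmod (z - w) = cmod (w - z).
Proof. by rewrite -cmodN opprB. Qed.

Lemma cmodB_le z w : cmod z - cmod w <= cmod (z - w).
Proof. by rewrite lerBlDr -{1}(subrK w z) cmodD. Qed.

Lemma cmod_dist_le z w : `|cmod z - cmod w| <= cmod (z - w).
Proof.
rewrite ler_norml cmodB_le andbT lerNl opprB.
by rewrite (le_trans (cmodB_le _ _))// cmod_distC.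
Qed.

Lemma cmod_le_ReIm z : cmod z <= `|complex.Re z| + `|complex.Im z|.
Proof.
case: z => a b; rewrite /cmod/=.
rewrite -(@ler_pXn2r _ 2) ?nnegrE ?addr_ge0 ?sqrtr_ge0//.
rewrite sqr_sqrtr ?addr_ge0 ?sqr_ge0// sqrrD !real_normK ?num_real//.
by rewrite lerD2r lerDl mulrn_wge0// mulr_ge0.
Qed.

Lemma normRe_le z : `|complex.Re z| <= cmod z.
Proof. by case: z => a b; rewrite -sqrtr_sqr ler_wsqrtr// lerDl sqr_ge0. Qed.

Lemma normIm_le z : `|complex.Im z| <= cmod z.
Proof.
by case: z => a b; rewrite -[leLHS]sqrtr_sqr ler_wsqrtr// lerDr sqr_ge0.
Qed.

Lemma cmodXB_le z w (rho : R) n : cmod z <= rho -> cmod w <= rho ->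
  cmod (w ^+ n - z ^+ n) <= n%:R * rho ^+ n.-1 * cmod (w - z).
Proof.
move=> zr wr; have r0 : 0 <= rho := le_trans (cmod_ge0 z) zr.
case: n => [|n]; first by rewrite !expr0 subrr cmod0 !mul0r.
elim: n => [|n IH]; first by rewrite !expr1 expr0 !mul1r.
have -> : w ^+ n.+2 - z ^+ n.+2 =
    w * (w ^+ n.+1 - z ^+ n.+1) + (w - z) * z ^+ n.+1.
  by rewrite (exprS w n.+1) (exprS z n.+1); ring.
apply: (le_trans (cmodD _ _)); rewrite !cmodM cmodX.
have H1 : cmod w * cmod (w ^+ n.+1 - z ^+ n.+1) <=
    rho * (n.+1%:R * rho ^+ n * cmod (w - z)).
  by apply: ler_pM => //; exact: cmod_ge0.
have H2 : cmod (w - z) * cmod z ^+ n.+1 <= cmod (w - z) * rho ^+ n.+1.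
  by apply: ler_wpM2l; [exact: cmod_ge0|rewrite lerXn2r// nnegrE cmod_ge0].
apply: (le_trans (lerD H1 H2)).
have -> : n.+2%:R = n.+1%:R + 1 :> R by rewrite natr1.
by rewrite /= exprS le_eqVlt; apply/orP; left; apply/eqP; ring.
Qed.

End modulus.

Section complex_derivative.
Context {R : realType}.
Implicit Types (f g : R[i] -> R[i]) (z w l m c : R[i]).

(** Differentiability with real epsilons and deltas, whereas the filters of
    [R[i]] range over complex radii. *)
Definition cderiv f z l := forall e : R, 0 < e -> exists2 d : R, 0 < d &
  forall v, cmod v <= d -> cmod (f (z + v) - f z - l * v) <= e * cmod v.

Lemma cderivP f z l : cderiv f z l <->
  (h^-1 *: (f (h + z) - f z) @[h --> 0^'] --> l)%classic.
Proof.
have quotE h : h != 0 -> l - h^-1 *: (f (h + z) - f z) =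
    - (h^-1 * (f (z + h) - f z - l * h)).
  by move=> h0; rewrite /GRing.scale/= (addrC h); field.
split=> [H|/cvgrPdist_le H e e0].
  apply/cvgrPdist_le => /= e /complex_gt0[r r0 ->].
  have [d d0 {}H] := H r r0.
  apply/nbhs_ballP; exists (d%:C)%C; first by rewrite /= ltcR.
  move=> h /=; rewrite -ball_normE/= sub0r normrN cmod_lt => hd h0.
  rewrite cmod_le quotE// cmodN cmodM cmodV ler_pdivrMl ?cmod_gt0//.
  by rewrite [leRHS]mulrC; apply: H; exact: ltW.
have /H : 0 < (e%:C)%C by rewrite ltcR.
move=> /nbhs_ballP[_ /= /complex_gt0[d d0 ->]] {}H.
exists (d / 2); first by rewrite divr_gt0.
move=> v vd; have [->|v0] := eqVneq v 0.
  by rewrite addr0 subrr mulr0 subr0 cmod0 mulr0.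
have vd' : ball (0 : R[i]) (d%:C)%C v.
  rewrite -ball_normE/= sub0r normrN cmod_lt (le_lt_trans vd)//.
  by rewrite ltr_pdivrMr// ltr_pMr// ltr1n.
have := H v vd' v0; rewrite cmod_le quotE//.
by rewrite cmodN cmodM cmodV ler_pdivrMl ?cmod_gt0// [leRHS]mulrC.
Qed.

Lemma derivable_cderiv f z : derivable f z 1 -> cderiv f z (derive1 f z).
Proof.
rewrite /derivable => H; apply/cderivP; rewrite /derive1.
suff E : (fun h => h^-1 *: (f (h *: 1 + z) - f z)) =
    (fun h => h^-1 *: (f (h + z) - f z)).
  by move: H; rewrite E => /cvgP.
by apply/funext => h; rewrite /GRing.scale/= mulr1.
Qed.

Lemma cderiv_derivable f z l : cderiv f z l -> derivable f z 1.
Proof.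
move=> /cderivP H; apply/cvg_ex; exists l.
by under eq_fun do rewrite /GRing.scale/= mulr1.
Qed.

Lemma cderiv_derive1 f z l : cderiv f z l -> derive1 f z = l.
Proof. by move=> /cderivP H; apply: cvg_lim. Qed.

Lemma cderivD f g z l m : cderiv f z l -> cderiv g z m ->
  cderiv (fun w => f w + g w) z (l + m).
Proof.
move=> H1 H2 e e0; have e20 : 0 < e / 2 by rewrite divr_gt0.
have [d1 d10 {}H1] := H1 _ e20; have [d2 d20 {}H2] := H2 _ e20.
exists (Num.min d1 d2); first by rewrite lt_min d10.
move=> v; rewrite le_min => /andP[/H1 {}H1 /H2 {}H2].
have -> : f (z + v) + g (z + v) - (f z + g z) - (l + m) * v =
  (f (z + v) - f z - l * v) + (g (z + v) - g z - m * v) by ring.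
by apply: (le_trans (cmodD _ _)); lra.
Qed.

Lemma cderivZ f z l c : cderiv f z l -> cderiv (fun w => c * f w) z (c * l).
Proof.
move=> H e e0.
have c0 : 0 < cmod c + 1 by rewrite ltr_wpDl// cmod_ge0.
have [|d d0 {}H] := H (e / (cmod c + 1)); first by rewrite divr_gt0.
exists d => // v /H{}H.
rewrite -mulrBr -mulrA -mulrBr cmodM.
apply: (@le_trans _ _ ((cmod c + 1) * (e / (cmod c + 1) * cmod v))).
  by apply: ler_pM => //; rewrite ?cmod_ge0 ?lerDl.
by rewrite le_eqVlt; apply/orP; left; apply/eqP; field; rewrite gt_eqF.
Qed.

Lemma cderivB f g z l m : cderiv f z l -> cderiv g z m ->
  cderiv (fun w => f w - g w) z (l - m).
Proof.
move=> Hf /(cderivZ (-1)); rewrite mulN1r => /(cderivD Hf).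
by under eq_fun do rewrite mulN1r.
Qed.

Lemma cderivX z n : cderiv (fun w => w ^+ n) z (n%:R * z ^+ n.-1).
Proof.
by have := derivable_cderiv (@exprn_derivable _ n z 1); rewrite exp_derive1.
Qed.

Lemma cderiv_translate f z w l : cderiv f (z + w) l ->
  cderiv (fun v => f (v + w)) z l.
Proof.
move=> H e /H[d d0 K]; exists d => // v vd.
by rewrite [_ + v + w]addrAC; exact: K.
Qed.

End complex_derivative.

(** * Circle means and Cauchy's estimate *)

Section cauchy.
Context {R : realType}.
Implicit Types (f g : R[i] -> R[i]) (z w l : R[i]).

Definition circle_pt (r t : R) : R[i] := ((r * cos t) +i* (r * sin t))%C.

Lemma cmod_circle_pt (r t : R) : cmod (circle_pt r t) = `|r|.
Proof. by rewrite /cmod/= !exprMn -mulrDr cos2Dsin2 mulr1 sqrtr_sqr. Qed.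

(** The complex exponential e^(s + it). *)
Definition polar (s t : R) : R[i] := circle_pt (expR s) t.

Lemma polarD s t h k : polar (s + h) (t + k) = polar s t * polar h k.
Proof.
rewrite /polar /circle_pt expRD cosD sinD; apply/eqP; rewrite eq_complex/=.
by apply/andP; split; apply/eqP; ring.
Qed.

Lemma cmod_polar s t : cmod (polar s t) = expR s.
Proof. by rewrite cmod_circle_pt ger0_norm ?expR_ge0. Qed.

Lemma polar_neq0 s t : polar s t != 0.
Proof. by rewrite -cmod_gt0 cmod_polar expR_gt0. Qed.

Lemma polar_2pi s : polar s (pi *+ 2) = polar s 0.
Proof. by rewrite /polar /circle_pt cos2pi sin2pi cos0 sin0. Qed.

Lemma is_derive_approx (f : R -> R) (l : R) :
  is_derive (0 : R) (1 : R) f l ->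
  forall e : R, 0 < e -> exists2 d : R, 0 < d &
    forall h, `|h| <= d -> `|f h - f 0 - l * h| <= e * `|h|.
Proof.
move=> df e e0.
have H : (h^-1 *: (f (h + 0) - f 0) @[h --> 0^'] --> l)%classic.
  have [df1 <-] := df; rewrite -derive1E /derive1.
  move: df1; rewrite /derivable.
  suff -> : (fun h : R => h^-1 *: ((f \o shift 0) (h *: (1 : R)) - f 0)) =
            (fun h => h^-1 *: (f (h + 0) - f 0)) by move=> /cvgP.
  by apply/funext => h; rewrite /= /GRing.scale/= mulr1.
move: H => /cvgrPdist_le/(_ _ e0)/nbhs_ballP[d /= d0 H].
exists (d / 2); first by rewrite divr_gt0.
move=> v vd; have [->|v0] := eqVneq v 0.
  by rewrite subrr mulr0 subr0 normr0 mulr0.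
have vd' : ball (0 : R) d v.
  rewrite -ball_normE/= sub0r normrN (le_lt_trans vd)//.
  by rewrite ltr_pdivrMr// ltr_pMr// ltr1n.
have := H v vd' v0; rewrite addr0 /GRing.scale/=.
have -> : l - v^-1 * (f v - f 0) = - (v^-1 * (f v - f 0 - l * v)) by field.
by rewrite normrN normrM normfV ler_pdivrMl ?normr_gt0// [leRHS]mulrC.
Qed.

(** The complex exponential has derivative 1 at 0. *)
Lemma polar_approx (e : R) : 0 < e -> exists2 d : R, 0 < d &
  forall h k, `|h| <= d -> `|k| <= d ->
    cmod (polar h k - 1 - (h +i* k)%C) <= e * (`|h| + `|k|).
Proof.
(* If n bounds the relative errors of exp, cos and sin, and |h| and |k| are at
   most n <= 1, then the error here is at most 8 n (|h| + |k|). *)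
move=> e0; set n : R := Num.min 1 (e / 8).
have n0 : 0 < n by rewrite /n lt_min ltr01 divr_gt0.
have n1 : n <= 1 by rewrite /n ge_min lexx.
have n8 : n * 8 <= e by rewrite -ler_pdivlMr// /n ge_min lexx orbT.
clearbody n.
have [d1 d10 H1] := is_derive_approx (is_derive_expR 0) n0.
have [d2 d20 H2] := is_derive_approx (is_derive_cos 0) n0.
have [d3 d30 H3] := is_derive_approx (is_derive_sin 0) n0.
exists (Num.min (Num.min d1 d2) (Num.min d3 n)).
  by rewrite !lt_min d10 d20 d30 n0.
move=> h k; rewrite !le_min => /andP[/andP[hd1 _] /andP[_ hn]].
move=> /andP[/andP[_ kd2] /andP[kd3 kn]].
have {H1} := H1 _ hd1; rewrite expR0 mul1r => H1.
have {H2} := H2 _ kd2; rewrite sin0 oppr0 mul0r cos0 subr0 => H2.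
have {H3} := H3 _ kd3; rewrite sin0 cos0 subr0 mul1r => H3.
have h0 := normr_ge0 h; have k0 := normr_ge0 k.
have nh : n * `|h| <= `|h| by rewrite ler_piMl.
have nk : n * `|k| <= `|k| by rewrite ler_piMl.
have E1 : `|expR h - 1| <= 2 * n.
  have := ler_normD (expR h - 1 - h) h; rewrite subrK; lra.
have E2 : `|expR h| <= 3.
  have := ler_normD (expR h - 1) 1; rewrite subrK normr1; lra.
have S1 : `|sin k| <= 2 * `|k|.
  have := ler_normD (sin k - k) k; rewrite subrK; lra.
have Pr : `|expR h * (cos k - 1)| <= 3 * (n * `|k|).
  by rewrite normrM ler_pM.
have Pi : `|(expR h - 1) * sin k| <= 2 * n * (2 * `|k|).
  by rewrite normrM ler_pM.
apply: (le_trans (cmod_le_ReIm _)).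
rewrite /= oppr0 addr0.
have -> : expR h * cos k - 1 - h =
  (expR h - 1 - h) + expR h * (cos k - 1) by ring.
have -> : expR h * sin k - k = (expR h - 1) * sin k + (sin k - k) by ring.
have := ler_normD (expR h - 1 - h) (expR h * (cos k - 1)).
have := ler_normD ((expR h - 1) * sin k) (sin k - k).
have := ler_wpM2r h0 n8; have := ler_wpM2r k0 n8.
have := mulr_ge0 (ltW n0) h0; have := mulr_ge0 (ltW n0) k0.
move: Pr Pi H1 H2 H3.
set X := n * `|h|; set Y := n * `|k|.
rewrite (_ : n * 8 * `|h| = 8 * X); last by rewrite /X; ring.
rewrite (_ : n * 8 * `|k| = 8 * Y); last by rewrite /Y; ring.
rewrite (_ : 2 * n * (2 * `|k|) = 4 * Y); last by rewrite /Y; ring.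
by clearbody X Y; lra.
Qed.

(** The chain rule for f composed with the exponential, whose derivative at
    s + it is [polar s t]; by [polarD] its increments there are those at 0 times
    [polar s t]. *)
Lemma cauchy_riemann_polar f s t l : cderiv f (polar s t) l ->
  cauchy_riemann_at (fun s t => complex.Re (f (polar s t)))
    (fun s t => complex.Im (f (polar s t))) s t.
Proof.
move=> H; set P := polar s t in H *.
exists (complex.Re (l * P)), (complex.Im (l * P)) => e e0.
set M := cmod P; have M0 : 0 < M by rewrite /M cmod_gt0 polar_neq0.
set L := cmod l; have L0 : 0 <= L := cmod_ge0 l.
have LM0 : 0 <= L * M by rewrite mulr_ge0// ltW.
have a0 : 0 < e / (4 * M) by rewrite divr_gt0// mulr_gt0.
have b0 : 0 < e / (2 * (L * M + 1)) by rewrite divr_gt0// mulr_gt0// ltr_wpDl.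
have [d1 d10 H1] := H _ a0.
have [d2 d20 H2] := polar_approx b0.
have [d3 d30 H3] := polar_approx ltr01.
exists (Num.min (d1 / (4 * M)) (Num.min d2 d3)).
  by rewrite !lt_min d20 d30 divr_gt0// mulr_gt0.
move=> h k; rewrite !le_min => /andP[hd1 /andP[hd2 hd3]].
move=> /andP[kd1 /andP[kd2 kd3]].
rewrite !polarD -/P.
set v := P * polar h k - P.
have hk0 : 0 <= `|h| + `|k| by rewrite addr_ge0.
have E1 : cmod (polar h k - 1) <= 2 * (`|h| + `|k|).
  have := cmodD (polar h k - 1 - (h +i* k)%C) (h +i* k)%C; rewrite subrK.
  have := H3 h k hd3 kd3; have := cmod_le_ReIm (h +i* k)%C => /=; lra.
have vE : v = P * (polar h k - 1) by rewrite /v mulrBr mulr1.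
have vM : cmod v <= M * (2 * (`|h| + `|k|)).
  by rewrite vE cmodM ler_wpM2l// ltW.
have vd : cmod v <= d1.
  apply: (le_trans vM).
  have : `|h| + `|k| <= d1 / (4 * M) + d1 / (4 * M) by apply: lerD.
  rewrite -[leRHS]mulrDl ler_pdivlMr ?mulr_gt0//; lra.
have {H1} H1 := H1 v vd.
have {H2} H2 := H2 h k hd2 kd2.
have PE : P * polar h k = P + v by rewrite /v subrKC.
rewrite PE.
have B : cmod (f (P + v) - f P - l * P * (h +i* k)%C) <= e * (`|h| + `|k|).
  have -> : f (P + v) - f P - l * P * (h +i* k)%C =
     (f (P + v) - f P - l * v) + l * P * (polar h k - 1 - (h +i* k)%C).
    by rewrite vE; ring.
  apply: (le_trans (cmodD _ _)); rewrite !cmodM -/L -/M.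
  have B1 : e / (4 * M) * cmod v <= e / 2 * (`|h| + `|k|).
    rewrite -mulrA; rewrite -mulrA; apply: ler_wpM2l; first exact: ltW.
    rewrite ler_pdivrMl ?mulr_gt0//; apply: (le_trans vM); lra.
  have B2 : L * M * cmod (polar h k - 1 - (h +i* k)%C) <=
      e / 2 * (`|h| + `|k|).
    have LM : L * M + 1 != 0 by rewrite lt0r_neq0// ltr_wpDl.
    have -> : e / 2 * (`|h| + `|k|) =
        (L * M + 1) * (e / (2 * (L * M + 1)) * (`|h| + `|k|)) by field.
    by apply: ler_pM => //; [exact: cmod_ge0|rewrite lerDl].
  have -> : e * (`|h| + `|k|) =
    e / 2 * (`|h| + `|k|) + e / 2 * (`|h| + `|k|) by lra.
  by apply: lerD => //; apply: le_trans H1 _.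
have := normRe_le (f (P + v) - f P - l * P * (h +i* k)%C).
have := normIm_le (f (P + v) - f P - l * P * (h +i* k)%C).
case: (f (P + v)) B => a1 b1; case: (f P) => a2 b2.
case: (l * P) => p q /= B i1 i2.
split; first exact: le_trans i2 B.
by rewrite (addrC (q * h)); apply: le_trans B.
Qed.

(** Goursat's theorem on [s1, s2] * [0, 2 pi]: the two sides t = 0 and t = 2 pi
    cancel because the exponential has period 2 pi i. *)
Lemma circle_mean_const f (s1 s2 : R) : s1 <= s2 ->
  (forall z, expR s1 <= cmod z <= expR s2 -> derivable f z 1) ->
  segint (fun t => complex.Re (f (polar s2 t)) - complex.Re (f (polar s1 t)))
    0 (pi *+ 2) = 0.
Proof.
move=> s12 df.
have pi0 : 0 <= pi *+ 2 :> R by rewrite mulrn_wge0// pi_ge0.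
have := @goursat R (fun s t => complex.Re (f (polar s t)))
  (fun s t => complex.Im (f (polar s t))) s1 s2 0 (pi *+ 2) _ s12 pi0.
rewrite /circulation => H; apply: (etrans _ (H _)).
  rewrite [X in X + _](_ : _ = segint (fun=> 0) s1 s2).
    by rewrite segint_cst// mul0r add0r.
  by apply: eq_Rintegral => s _; rewrite polar_2pi subrr.
move=> s t /andP[ss1 ss2] _.
apply: cauchy_riemann_polar; apply: derivable_cderiv.
by apply: df; rewrite cmod_polar !ler_expR ss1.
Qed.

(** Let D = f'(z0) and g(w) = conj(D) (f(z0 + w) - f(z0)) / w.  On the circle of
    radius rho, Re g <= |D| M / rho, while on small circles Re g is close to
    Re (conj(D) D) = |D|^2.  The means of Re g on both circles are equal, so
    |D|^2 <= |D| M / rho. *)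
Lemma cauchy_estimate f z0 (rho M : R) : 0 < rho ->
  (forall z, cmod z <= rho -> derivable f (z0 + z) 1) ->
  (forall z, cmod z = rho -> cmod (f (z0 + z) - f z0) <= M) ->
  cmod (derive1 f z0) <= M / rho.
Proof.
move=> rho0 df fM; set D := derive1 f z0.
rewrite leNgt; apply/negP => MD.
have M0 : 0 <= M.
  apply: le_trans (fM (rho%:C)%C _); first exact: cmod_ge0.
  by rewrite cmodC ger0_norm// ltW.
have D0 : 0 < cmod D by apply: le_lt_trans MD; rewrite divr_ge0// ltW.
pose g w : R[i] := (D^*)%C * ((f (z0 + w) - f z0) / w).
have dg w : w != 0 -> cmod w <= rho -> derivable g w 1.
  move=> w0 wr; apply: (@derivableM _ _ (cst (D^*)%C)).
    exact: derivable_cst.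
  apply: (@derivableM _ _ (fun w => f (z0 + w) - f z0)).
    apply: derivableB; last exact: derivable_cst.
    under eq_fun do rewrite addrC.
    apply: cderiv_derivable (cderiv_translate (derivable_cderiv _)).
    by rewrite addrC; exact: df.
  by apply: derivableV => //; exact: derivable_id.
have ReJ : complex.Re ((D^*)%C * D) = cmod D ^+ 2.
  rewrite /cmod; case: (D) => a b /=.
  by rewrite sqr_sqrtr ?addr_ge0 ?sqr_ge0//; ring.
set gap := cmod D - M / rho.
have gap0 : 0 < gap by rewrite subr_gt0.
have gap20 : 0 < gap / 2 by rewrite divr_gt0.
have df0 : derivable f z0 1.
  by rewrite -[z0]addr0; apply: df; rewrite cmod0 ltW.
have [d d0 Hd] := derivable_cderiv df0 gap20.
set s2 := ln rho; set s1 := ln (Num.min rho d).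
have md : 0 < Num.min rho d by rewrite lt_min rho0.
have s12 : s1 <= s2 by rewrite /s1 /s2 ler_ln ?posrE// ge_min lexx.
have es2 : expR s2 = rho by rewrite lnK ?posrE.
have es1 : expR s1 = Num.min rho d by rewrite lnK ?posrE.
have dg' z : expR s1 <= cmod z <= expR s2 -> derivable g z 1.
  move=> /andP[z1 z2]; apply: dg; last by rewrite -es2.
  by rewrite -cmod_gt0 (lt_le_trans _ z1)// expR_gt0.
have := circle_mean_const s12 dg'.
have pi0 : 0 <= pi *+ 2 :> R by rewrite mulrn_wge0// pi_ge0.
set F := (X in segint X _ _).
have Fc t : {for t, continuous F}.
  have aux s : s1 <= s <= s2 ->
      {for t, continuous (fun t => complex.Re (g (polar s t)))}.
    move=> sI; have [] // := @cauchy_riemann_continuous R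
      (fun s t => complex.Re (g (polar s t)))
      (fun s t => complex.Im (g (polar s t))) s t.
    apply: cauchy_riemann_polar; apply: derivable_cderiv; apply: dg'.
    by rewrite cmod_polar !ler_expR.
  by apply: cvgB; apply: aux; rewrite lexx s12.
have Fle t : F t <= - (cmod D * gap / 2).
  have U2 : complex.Re (g (polar s2 t)) <= cmod D * (M / rho).
    apply: le_trans (ler_norm _) _; apply: le_trans (normRe_le _) _.
    rewrite /g !cmodM cmodJ cmodV cmod_polar es2 ler_pM2l//.
    by rewrite ler_pM2r ?invr_gt0//; apply: fM; rewrite cmod_polar es2.
  have U1 : cmod D ^+ 2 - cmod D * (gap / 2) <= complex.Re (g (polar s1 t)).
    set w := polar s1 t.
    have w0 : w != 0 := polar_neq0 s1 t.
    have wd : cmod w <= d by rewrite cmod_polar es1 ge_min lexx orbT.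
    have gw : g w - (D^*)%C * D = (D^*)%C * ((f (z0 + w) - f z0 - D * w) / w).
      by rewrite /g; field.
    have : cmod (g w - (D^*)%C * D) <= cmod D * (gap / 2).
      rewrite gw !cmodM cmodJ cmodV ler_pM2l// ler_pdivrMr ?cmod_gt0//.
      exact: Hd.
    move=> /(le_trans (normRe_le _)).
    have -> : complex.Re (g w - (D^*)%C * D) =
        complex.Re (g w) - complex.Re ((D^*)%C * D).
      by case: (g w) => a b; case: (_ * D).
    by rewrite ReJ ler_distl => /andP[].
  rewrite /F; move: U1 U2.
  have -> : cmod D ^+ 2 = cmod D * gap + cmod D * (M / rho).
    by rewrite -mulrDr subrK.
  rewrite !mulrA; lra.
have := ler_segint_cst pi0 (fun t _ => Fc t) (fun t _ => Fle t).
rewrite subr0 => H E; move: H; rewrite E leNgt => /negP; apply.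
rewrite mulNr oppr_lt0 mulr_gt0//; last by rewrite pmulrn_lgt0// pi_gt0.
by rewrite divr_gt0// mulr_gt0.
Qed.

End cauchy.

(** * Derivatives of functions of the disk algebra *)

Section disk.
Context {R : realType}.
Implicit Types (f g : disk_algebra R) (z w l : R[i]).

Lemma closed_diskE z : closed_disk z <-> cmod z <= 1.
Proof. by rewrite /closed_disk/= -cmod_le. Qed.

Lemma open_diskE z : open_disk z <-> cmod z < 1.
Proof. by rewrite /open_disk/= -cmod_lt. Qed.

Lemma disk_norm_ge0 f : 0 <= disk_norm f.
Proof.
apply: le_trans (cmod_ge0 _) (disk_norm_ub f (_ : closed_disk 0)).
by apply/closed_diskE; rewrite cmod0.
Qed.

Lemma within_diskP (h : R[i] -> R[i]) :
  {within @closed_disk R, continuous h} <->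
  forall z, cmod z <= 1 -> forall e : R, 0 < e -> exists2 d : R, 0 < d &
    forall w, cmod w <= 1 -> cmod (w - z) <= d -> cmod (h w - h z) <= e.
Proof.
split.
  move=> /subspace_continuousP ch z /closed_diskE zD e e0.
  have := ch z zD; move=> /cvgrPdist_le/(_ (e%:C)%C); rewrite ltcR => /(_ e0).
  rewrite near_withinE => /nbhs_ballP[_ /= /complex_gt0[d d0 ->]] H.
  exists (d / 2); first by rewrite divr_gt0.
  move=> w /closed_diskE w1 wd; have := H w.
  rewrite -ball_normE/= cmod_lt cmod_le (cmod_distC z) (cmod_distC (h z)).
  by apply=> //; rewrite (le_lt_trans wd)// ltr_pdivrMr// ltr_pMr// ltr1n.
move=> H; apply/subspace_continuousP => z zD.
apply/cvgrPdist_le => _ /complex_gt0[e e0 ->].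
have [d d0 {}H] := H z (proj1 (closed_diskE z) zD) e e0.
rewrite near_withinE; apply/nbhs_ballP.
exists (d%:C)%C; first by rewrite /= ltcR.
move=> w; rewrite -ball_normE/= cmod_lt cmod_le => zw /closed_diskE w1.
by rewrite cmod_distC H// cmod_distC ltW.
Qed.

Lemma disk_unif_continuous f (e : R) : 0 < e -> exists2 d : R, 0 < d &
  forall z w, cmod z <= 1 -> cmod w <= 1 -> cmod (w - z) <= d ->
    cmod (f w - f z) <= e.
Proof.
move=> e0; have /asboolP[/within_diskP cf _ _] := disk_funP f.
pose P (d : R) z := cmod z <= 1 -> forall w, cmod w <= 1 ->
  cmod (w - z) <= d -> cmod (f w - f z) <= e.
have /compact_near_coveringP/(_ _ (0^'+) P) := @compact_closed_disk R.
case.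
  move=> z /closed_diskE z1.
  have e20 : 0 < e / 2 by rewrite divr_gt0.
  have [d d0 H] := cf z z1 _ e20.
  have d20 : 0 < d / 2 by rewrite divr_gt0.
  exists (ball z ((d / 2)%:C)%C, [set x : R | 0 < x < d / 2]) => /=.
    split; first by apply: nbhsx_ballx; rewrite ltcR.
    near=> x; rewrite /=; apply/andP; split.
      by near: x; exact: nbhs_right_gt.
    by near: x; apply: nbhs_right_lt.
  move=> [z' x] /= [zz' /andP[x0 xd]] z'1 w w1 wz'.
  move: zz'; rewrite -ball_normE/= cmod_lt => zz'.
  have H1 : cmod (f z' - f z) <= e / 2.
    by apply: H => //; rewrite cmod_distC; lra.
  have H2 : cmod (f w - f z) <= e / 2.
    apply: H => //; have := cmodD (w - z') (z' - z).
    by rewrite addrA subrK (cmod_distC z'); lra.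
  have := cmodD (f w - f z) (f z - f z'); rewrite addrA subrK.
  by rewrite (cmod_distC (f z)); lra.
move=> d /= d0 H.
exists (d / 2); first by rewrite divr_gt0.
move=> z w z1 w1 wz; apply: (H (d / 2)) => //=.
- rewrite /ball_/= sub0r normrN gtr0_norm ?divr_gt0//.
  by rewrite ltr_pdivrMr// ltr_pMr// ltr1n.
- by rewrite divr_gt0.
- exact/closed_diskE.
Unshelve. all: by end_near. Qed.

Lemma disk_cderiv f z : cmod z < 1 -> cderiv f z (derive1 f z).
Proof.
have /asboolP[_ df _] := disk_funP f.
by move=> /open_diskE z1; exact/derivable_cderiv/df.
Qed.

Lemma disk_derive1_le f z : cmod z < 1 ->
  cmod (derive1 f z) <= 4 / (1 - cmod z) * disk_norm f.
Proof.
move=> z1; set rho := (1 - cmod z) / 2.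
have rho0 : 0 < rho by rewrite divr_gt0// subr_gt0.
have -> : 4 / (1 - cmod z) * disk_norm f = (2 * disk_norm f) / rho.
  by rewrite /rho; field; rewrite subr_eq0 gt_eqF.
have zw w : cmod w <= rho -> cmod (z + w) < 1.
  by rewrite /rho => wr; have := cmodD z w; lra.
apply: cauchy_estimate => // w wrho.
  exact/cderiv_derivable/disk_cderiv/zw.
apply: (le_trans (cmodD _ _)); rewrite cmodN.
have H1 : cmod (f (z + w)) <= disk_norm f.
  by apply/disk_norm_ub/closed_diskE/ltW/zw; rewrite wrho.
have H2 : cmod (f z) <= disk_norm f by apply/disk_norm_ub/closed_diskE/ltW.
lra.
Qed.

(** Cauchy's estimate for v |-> f(v + w) - f(v), which is uniformly small when w
    is, because f is uniformly continuous. *)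
Lemma disk_derive1_continuous f z (e : R) : cmod z < 1 -> 0 < e ->
  exists2 d : R, 0 < d & forall w, cmod w <= d ->
    cmod (derive1 f (z + w) - derive1 f z) <= e.
Proof.
move=> z1 e0; set rho := (1 - cmod z) / 3.
have rho0 : 0 < rho by rewrite divr_gt0// subr_gt0.
have e'0 : 0 < e * rho / 2 by rewrite divr_gt0// mulr_gt0.
have [d d0 H] := disk_unif_continuous f e'0.
exists (Num.min d rho); first by rewrite lt_min d0.
move=> w; rewrite le_min => /andP[wd wr].
pose g v := f (v + w) - f v.
have zv v : cmod v <= rho -> cmod (z + v) < 1.
  by rewrite /rho => vr; have := cmodD z v; lra.
have zvw v : cmod v <= rho -> cmod (z + v + w) < 1.
  rewrite /rho in wr *; move=> vr.
  by have := cmodD (z + v) w; have := cmodD z v; lra.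
have dg v : cmod v <= rho ->
    cderiv g (z + v) (derive1 f (z + v + w) - derive1 f (z + v)).
  move=> vr; apply: cderivB; last exact/disk_cderiv/zv.
  exact/cderiv_translate/disk_cderiv/zvw.
have cm0 : cmod (0 : R[i]) <= rho by rewrite cmod0 ltW.
have := cderiv_derive1 (dg 0 cm0); rewrite addr0 => <-.
have -> : e = (2 * (e * rho / 2)) / rho by field; rewrite gt_eqF.
have gle v : cmod v <= rho -> cmod (g (z + v)) <= e * rho / 2.
  move=> vr; apply: H; [exact/ltW/zv|exact/ltW/zvw|].
  by rewrite [z + v + w]addrC addrK.
apply: cauchy_estimate => // v vr; first exact: cderiv_derivable (dg v vr).
apply: (le_trans (cmodD _ _)); rewrite cmodN.
have : cmod (g (z + v)) <= e * rho / 2 by apply: gle; rewrite vr.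
have := gle 0 cm0; rewrite addr0; lra.
Qed.

Lemma disk_derive1B f g z : cmod z < 1 ->
  derive1 (f - g) z = derive1 f z - derive1 g z.
Proof.
by move=> z1; apply: cderiv_derive1; apply: cderivB; exact: disk_cderiv.
Qed.

End disk.

(** * The logarithmic means *)

Section means.
Context {R : realType}.
Implicit Types f g : disk_algebra R.

Lemma log_plusE (t : R) : log_plus t = ln (Num.max 1 t).
Proof.
rewrite /log_plus; case: ltP => t0; last by rewrite max_l ?ln1// (le_trans t0).
case: (leP 1 t) => t1; first by rewrite max_r// ln_ge0.
by rewrite max_l// ?ln1// ln_le0// ltW.
Qed.

Lemma log_plus_ge0 (t : R) : 0 <= log_plus t.
Proof. by rewrite log_plusE ln_ge0// le_max lexx. Qed.

Lemma le_log_plus (s t : R) : s <= t -> log_plus s <= log_plus t.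
Proof.
move=> st; rewrite !log_plusE ler_ln ?posrE ?lt_max ?ltr01//.
by rewrite ge_max !le_max lexx st orbT.
Qed.

(** ln (y / x) <= y / x - 1 <= y - x for 1 <= x <= y. *)
Lemma log_plus_lipschitz (s t : R) : `|log_plus s - log_plus t| <= `|s - t|.
Proof.
wlog st : s t / s <= t.
  move=> H; case/orP: (le_total s t) => [/H//|/H].
  by rewrite distrC (distrC t).
rewrite distrC (distrC s) !ger0_norm ?subr_ge0 ?le_log_plus//.
rewrite !log_plusE; set x := Num.max 1 s; set y := Num.max 1 t.
have x1 : 1 <= x by rewrite /x le_max lexx.
have y1 : 1 <= y by rewrite /y le_max lexx.
have x0 : 0 < x by apply: lt_le_trans x1.
have y0 : 0 < y by apply: lt_le_trans y1.
have xy : y - x <= t - s.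
  by rewrite /x /y; case: (leP 1 s) => s1; case: (leP 1 t) => t1; lra.
have xy0 : x <= y by rewrite /x /y ge_max !le_max lexx st orbT.
apply: le_trans xy.
rewrite -ln_div ?posrE//.
have := @le_ln1Dx R (y / x - 1); rewrite subrKC.
have xyd : 0 < y / x by rewrite divr_gt0.
move=> /(_ _)/le_trans; apply; first by lra.
have -> : y / x - 1 = (y - x) / x by field; rewrite gt_eqF.
by rewrite ler_pdivrMr// ler_peMr// subr_ge0.
Qed.

Lemma log_plus_derive1_continuous f (r : R) : 0 < r < 1 ->
  continuous (fun t => log_plus (cmod (derive1 f (circle_pt r t)))).
Proof.
move=> /andP[r0 r1] t; apply/cvgrPdist_le => /= e e0.
have zt : cmod (circle_pt r t) < 1 by rewrite cmod_circle_pt gtr0_norm.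
have [d d0 H] := disk_derive1_continuous f zt e0.
have d20 : 0 < d / 2 by rewrite divr_gt0.
near=> s.
rewrite distrC (le_trans (log_plus_lipschitz _ _))//.
rewrite (le_trans (cmod_dist_le _ _))//.
rewrite -[X in derive1 _ X - _](subrKC (circle_pt r t)); apply: H.
apply: (le_trans (cmod_le_ReIm _)) => /=.
have C : `|cos s - cos t| <= d / 2.
  near: s; have /cvgrPdist_le/(_ _ d20) := @continuous_cos R t.
  by apply: filterS => s; rewrite distrC.
have S : `|sin s - sin t| <= d / 2.
  near: s; have /cvgrPdist_le/(_ _ d20) := @continuous_sin R t.
  by apply: filterS => s; rewrite distrC.
rewrite -!mulrBr !normrM (gtr0_norm r0).
have C' : r * `|cos s - cos t| <= `|cos s - cos t| by rewrite ler_piMl// ltW.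
have S' : r * `|sin s - sin t| <= `|sin s - sin t| by rewrite ler_piMl// ltW.
lra.
Unshelve. all: by end_near. Qed.

Lemma log_plus_meanE (A B : R) f r : log_plus_mean A B f r =
  segint (fun t => log_plus (cmod (derive1 f (circle_pt r t)))) A B.
Proof. by []. Qed.

Lemma log_plus_mean_lipschitz (A B : R) f g r : A <= B -> 0 < r < 1 ->
  `|log_plus_mean A B f r - log_plus_mean A B g r| <=
    4 / (1 - r) * disk_norm (f - g) * (B - A).
Proof.
move=> AB r01; have [r0 r1] := andP r01.
rewrite !log_plus_meanE -segintB; last 2 first.
  by move=> t _; exact: log_plus_derive1_continuous.
  by move=> t _; exact: log_plus_derive1_continuous.
rewrite -[X in `|X|]subr0 -[X in _ - X](mul0r (B - A)).
apply: segint_dist => //.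
  by move=> t _; apply: cvgB; exact: log_plus_derive1_continuous.
move=> t _; rewrite subr0 (le_trans (log_plus_lipschitz _ _))//.
rewrite (le_trans (cmod_dist_le _ _))//.
have zt : cmod (circle_pt r t) = r by rewrite cmod_circle_pt gtr0_norm.
rewrite -disk_derive1B ?zt// -[X in _ / (1 - X)]zt.
by apply: disk_derive1_le; rewrite zt.
Qed.

Lemma open_log_plus_mean_gt (A B M r : R) : A <= B -> 0 < r < 1 ->
  open [set f : disk_algebra R | M < log_plus_mean A B f r].
Proof.
move=> AB r01; rewrite openE => f /= fM; apply/nbhs_ballP.
have [r0 r1] := andP r01.
set K := 4 / (1 - r) * (B - A) + 1.
have K0 : 0 < K by rewrite ltr_wpDl// mulr_ge0 ?divr_ge0 ?subr_ge0// ltW.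
exists (((log_plus_mean A B f r - M) / K)%:C)%C.
  by rewrite /= ltcR divr_gt0// subr_gt0.
move=> g; rewrite -ball_normE/= ltcR => fg.
have := log_plus_mean_lipschitz f g AB r01.
rewrite ltr_pdivlMr// in fg.
rewrite ler_norml => /andP[_].
have -> : 4 / (1 - r) * disk_norm (f - g) * (B - A) =
    disk_norm (f - g) * K - disk_norm (f - g).
  by rewrite /K; ring.
have aux (a b n : R) : 0 <= n -> n * K < a - M -> a - b <= n * K - n -> M < b.
  clearbody K; lra.
exact: aux (disk_norm_ge0 _) fg.
Qed.

Lemma log_plus_mean_ge0 (A B : R) f r : 0 <= log_plus_mean A B f r.
Proof. by apply: Rintegral_ge0 => t _; exact: log_plus_ge0. Qed.

Lemma le_log_plus_mean (A a b B : R) f r :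
  A <= a -> a <= b -> b <= B -> 0 < r < 1 ->
  log_plus_mean a b f r <= log_plus_mean A B f r.
Proof.
move=> Aa ab bB r01; have cf := @log_plus_derive1_continuous f r r01.
have aB := le_trans ab bB.
rewrite !log_plus_meanE (segint_split Aa aB) ?(segint_split ab bB)//.
rewrite addrCA lerDl addr_ge0//.
  exact: (log_plus_mean_ge0 A a).
exact: (log_plus_mean_ge0 b B).
all: by move=> t _; exact: cf.
Qed.

Lemma unbounded_meansP f : unbounded_means f <->
  forall A B : R, A < B -> forall M : R,
    exists2 r : R, 0 < r < 1 & M < log_plus_mean A B f r.
Proof.
split=> [uf A B AB M|H A B AB].
  apply: contrapT => nex; apply: (uf A B AB).
  exists M; split; first exact: num_real.
  move=> K MK r /=; rewrite in_itv/= => r01.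
  rewrite ger0_norm ?log_plus_mean_ge0//.
  rewrite leNgt; apply/negP => Kr; apply: nex; exists r => //.
  exact: lt_trans Kr.
case=> M [_ bM].
have [r r01 Mr] := H A B AB (M + 1).
have := bM (M + 1) _ r; rewrite ltrDl ltr01 => /(_ isT).
rewrite /= in_itv/= => /(_ r01); rewrite ger0_norm ?log_plus_mean_ge0//.
by rewrite leNgt Mr.
Qed.

Lemma ereal_sup_means f (A B : R) : unbounded_means f -> A < B ->
  ereal_sup [set (log_plus_mean A B f r)%:E | r in `]0, 1[] = +oo%E.
Proof.
move=> /unbounded_meansP uf AB; apply/eqyP => M _.
have [r r01 /ltW Mr] := uf A B AB M.
apply: (@le_trans _ _ (log_plus_mean A B f r)%:E); first by rewrite lee_fin.
by apply: ereal_sup_ubound; exists r.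
Qed.

(** The index is (p, q, m); it gives no constraint unless p < q, so that the
    family is indexed by the whole of a countable type. *)
Definition means_above (pqm : rat * rat * nat) : set (disk_algebra R) :=
  if (pqm.1.1 < pqm.1.2)%R then
    \bigcup_(r in [set r : R | 0 < r < 1])
      [set f | pqm.2%:R < log_plus_mean (ratr pqm.1.1) (ratr pqm.1.2) f r]
  else setT.

Lemma open_means_above pqm : open (means_above pqm).
Proof.
rewrite /means_above; case: ifPn => pq; last exact: openT.
apply: bigcup_open => r r01; apply: open_log_plus_mean_gt => //.
by rewrite ler_rat ltW.
Qed.

(** Rational arcs suffice: the means over an arc dominate those over any smaller
    arc, and every arc contains a rational one. *)
Lemma unbounded_meansE : @unbounded_means R = \bigcap_pqm means_above pqm.
Proof.
apply/seteqP; split=> f.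
  move=> /unbounded_meansP uf [[p q] m] _; rewrite /means_above/=.
  case: ifPn => // pq; have [|r r01 mr] := uf (ratr p) (ratr q) _ m%:R.
    by rewrite ltr_rat.
  by exists r.
move=> H; apply/unbounded_meansP => A B AB M.
have [p] := rat_in_itvoo AB; rewrite in_itv/= => /andP[Ap pB].
have [q] := rat_in_itvoo pB; rewrite in_itv/= => /andP[pq qB].
have := H (p, q, Num.bound `|M|) I; rewrite /means_above/=.
rewrite -(ltr_rat R) pq => -[r r01 /= Mr]; exists r => //.
apply: lt_le_trans (le_log_plus_mean f (ltW Ap) (ltW pq) (ltW qB) r01).
by apply: lt_trans Mr; apply: le_lt_trans (ler_norm _) (archi_boundP _).
Qed.

Lemma Gdelta_unbounded_means : Gdelta (@unbounded_means R).
Proof.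
exists (fun n => if unpickle n is Some pqm then means_above pqm else setT).
  by move=> n; case: unpickle => [pqm|]; [exact: open_means_above|exact: openT].
rewrite unbounded_meansE; apply/seteqP; split=> f H.
  by move=> n _; case: unpickle => // pqm; exact: H.
by move=> pqm _; have := H (pickle pqm) I; rewrite pickleK.
Qed.

(** A pointwise condition that implies membership in [unbounded_means] and that,
    by the triangle inequality, is stable under the addition of a function with
    bounded derivative. *)
Definition derivative_blowup f := forall M : R, exists2 r : R, 0 < r < 1 &
  forall z, cmod z = r -> M <= cmod (derive1 f z).

Lemma derivative_blowup_unbounded f : derivative_blowup f -> unbounded_means f.
Proof.
move=> bf; apply/unbounded_meansP => A B AB M.
set L := (`|M| + 1) / (B - A).
have BA : 0 < B - A by rewrite subr_gt0.
have L0 : 0 <= L by rewrite divr_ge0 ?ltW// addr_gt0 ?ltr01.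
have [r r01 H] := bf (expR L); exists r => //.
apply: (@lt_le_trans _ _ (L * (B - A))).
  by rewrite divfK ?gt_eqF//; have := ler_norm M; lra.
rewrite log_plus_meanE; apply: ger_segint_cst; first exact: ltW.
  by move=> t _; exact: log_plus_derive1_continuous.
have [r0 _] := andP r01.
move=> t _; apply: (@le_trans _ _ (log_plus (expR L))).
  by rewrite log_plusE max_r ?expRK// -expR0 ler_expR.
by apply: le_log_plus; apply: H; rewrite cmod_circle_pt gtr0_norm.
Qed.

End means.

(** * The lacunary series *)

Section geometric_limits.
Context {R : realType}.
Implicit Types K : R.

Lemma le_of_geometric (x y K : R) : (forall n, x <= y + K / 2 ^+ n) -> x <= y.
Proof.
move=> H; apply/ler_addgt0Pr => e e0; have [n Kn] := geometric_small K e0.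
by apply: (le_trans (H n)); rewrite lerD2l.
Qed.

Lemma real_geometric_cauchy (u : nat -> R) K :
  (forall n m, (n <= m)%N -> `|u m - u n| <= K / 2 ^+ n) ->
  exists l : R, forall n, `|l - u n| <= K / 2 ^+ n.
Proof.
move=> H.
have cu : cvgn u.
  apply/cauchy_cvgP/cauchy_exP => e /= e0.
  have e20 : 0 < e / 2 by rewrite divr_gt0.
  have [n Kn] := geometric_small K e20.
  exists (u n); exists n => // m /= nm.
  rewrite -ball_normE/= distrC (le_lt_trans (H _ _ nm))//.
  by rewrite (le_lt_trans Kn)// ltr_pdivrMr// ltr_pMr// ltr1n.
exists (limn u) => n.
have c1 : `|u m - u n| @[m --> \oo] --> `|limn u - u n|.
  by apply: cvg_norm; apply: cvgB => //; exact: cvg_cst.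
by apply: cvgr_to_le c1 _; exists n => // m /= /H.
Qed.

(** The bound K / 2^n - K / 2^m telescopes. *)
Lemma geometric_dist (u : nat -> R[i]) K :
  (forall n, cmod (u n.+1 - u n) <= K / 2 ^+ n.+1) ->
  forall n m, (n <= m)%N -> cmod (u m - u n) <= K / 2 ^+ n.
Proof.
move=> H n m nm.
have K0 : 0 <= K.
  have := le_trans (cmod_ge0 _) (H 0%N).
  by rewrite pmulr_lge0// invr_gt0 exprn_gt0.
suff : cmod (u m - u n) <= K / 2 ^+ n - K / 2 ^+ m.
  by move/le_trans; apply; rewrite gerBl divr_ge0// exprn_ge0.
elim: m nm => [|m IH].
  by rewrite leqn0 => /eqP ->; rewrite !subrr cmod0.
rewrite leq_eqVlt => /orP[/eqP->|]; first by rewrite !subrr cmod0.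
rewrite ltnS => /IH {}IH.
have := cmodD (u m.+1 - u m) (u m - u n); rewrite addrA subrK.
have E : K / 2 ^+ m = K / 2 ^+ m.+1 + K / 2 ^+ m.+1.
  by rewrite exprS; field; rewrite expf_neq0.
have := H m; lra.
Qed.

Lemma geometric_limit (u : nat -> R[i]) K :
  (forall n, cmod (u n.+1 - u n) <= K / 2 ^+ n.+1) ->
  exists l, forall n, cmod (l - u n) <= K / 2 ^+ n.
Proof.
move=> /geometric_dist H.
have [|a Ha] := @real_geometric_cauchy (fun n => complex.Re (u n)) K.
  move=> n m /H; apply: le_trans; apply: le_trans (normRe_le _).
  by case: (u m); case: (u n).
have [|b Hb] := @real_geometric_cauchy (fun n => complex.Im (u n)) K.
  move=> n m /H; apply: le_trans; apply: le_trans (normIm_le _).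
  by case: (u m); case: (u n).
exists (a +i* b)%C => n; apply: (@le_of_geometric _ _ (2 * K)) => p.
have := cmodD ((a +i* b)%C - u (n + p)%N) (u (n + p)%N - u n).
rewrite addrA subrK.
have := H n (n + p)%N (leq_addr _ _).
have := cmod_le_ReIm ((a +i* b)%C - u (n + p)%N).
have := Ha (n + p)%N; have := Hb (n + p)%N.
have : K / 2 ^+ (n + p) <= K / 2 ^+ p.
  have K0 : 0 <= K.
    by have := le_trans (cmod_ge0 _) (H 0 0 isT); rewrite expr0 divr1.
  rewrite ler_wpM2l// lef_pV2 ?posrE ?exprn_gt0// ler_weXn2l// ?ler1n//.
  exact: leq_addl.
case: (u (n + p)%N) => c d /=; rewrite -[2 * K / _]mulrA; lra.
Qed.

End geometric_limits.

Section lacunary.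
Context {R : realType}.
Implicit Types (z w l : R[i]) (h : R[i] -> R[i]).

Definition lac_term j z : R[i] := ((2 ^- j)%:C)%C * z ^+ (64 ^ j).
Definition lac_sum n z : R[i] := \sum_(j < n) lac_term j z.
Definition lac_dterm j z : R[i] := ((32 ^+ j)%:C)%C * z ^+ (64 ^ j).-1.
Definition lac_dsum n z : R[i] := \sum_(j < n) lac_dterm j z.

Lemma lac_coef j : 2 ^- j * (64 ^ j)%:R = 32 ^+ j :> R.
Proof. rewrite natrX -[LHS]mulrC -expr_div_n; congr (_ ^+ _); lra. Qed.

Lemma cderiv_lac_sum n z : cderiv (lac_sum n) z (lac_dsum n z).
Proof.
elim: n => [|n IH].
  rewrite /lac_dsum big_ord0 => e e0; exists 1 => // v _.
  by rewrite /lac_sum !big_ord0 mul0r !subr0 cmod0 mulr_ge0 ?cmod_ge0 ?ltW.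
have -> : lac_sum n.+1 = (fun w => lac_sum n w + lac_term n w).
  by apply/funext => w; rewrite /lac_sum big_ord_recr.
rewrite /lac_dsum big_ord_recr; apply: cderivD => //.
have -> : lac_dterm n z = ((2 ^- n)%:C)%C * ((64 ^ n)%:R * z ^+ (64 ^ n).-1).
  rewrite /lac_dterm mulrA -lac_coef rmorphM/=; congr (_ * _ * _).
  by rewrite rmorph_nat.
exact/cderivZ/cderivX.
Qed.

Lemma lac_sumS n z : lac_sum n.+1 z - lac_sum n z = lac_term n z.
Proof. by rewrite /lac_sum big_ord_recr/= [X in X - _]addrC addrK. Qed.

Lemma lac_dsumS n z : lac_dsum n.+1 z - lac_dsum n z = lac_dterm n z.
Proof. by rewrite /lac_dsum big_ord_recr/= [X in X - _]addrC addrK. Qed.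

Lemma lac_term_le j z : cmod z <= 1 -> cmod (lac_term j z) <= 2 / 2 ^+ j.+1.
Proof.
move=> z1; rewrite /lac_term cmodM cmodC cmodX.
have -> : 2 / 2 ^+ j.+1 = 2 ^- j :> R.
  by rewrite exprS; field; rewrite expf_neq0.
rewrite ger0_norm ?invr_ge0 ?exprn_ge0// ler_piMr ?invr_ge0 ?exprn_ge0//.
by rewrite exprn_ile1// cmod_ge0.
Qed.

Definition lac_radius k : R := 1 - (2 * 64 ^+ k)^-1.

Lemma lac_radius_bounds k : 1 / 2 <= lac_radius k < 1.
Proof.
have p0 : 0 < 64 ^+ k :> R by rewrite exprn_gt0.
have p1 : 1 <= 64 ^+ k :> R by rewrite exprn_ege1// ler1n.
have : 0 < (2 * 64 ^+ k)^-1 :> R by rewrite invr_gt0 mulr_gt0.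
have : (2 * 64 ^+ k)^-1 <= 2^-1 :> R.
  by rewrite lef_pV2 ?posrE ?mulr_gt0//; lra.
rewrite /lac_radius; lra.
Qed.

Lemma lac_radius_incr k : lac_radius k < lac_radius k.+1.
Proof.
rewrite /lac_radius ltrD2l ltrN2 ltf_pV2 ?posrE ?mulr_gt0 ?exprn_gt0//.
by rewrite ltr_pM2l// exprS ltr_pMl ?exprn_gt0// ltr1n.
Qed.

Lemma lt_lac_radius (x : R) : x < 1 -> exists k, x < lac_radius k.
Proof.
move=> x1; have x10 : 0 < 1 - x by rewrite subr_gt0.
have [k xk] := geometric_small 1 x10; exists k.
suff : (2 * 64 ^+ k)^-1 < 1 / 2 ^+ k :> R by rewrite /lac_radius; lra.
rewrite div1r ltf_pV2 ?posrE ?mulr_gt0 ?exprn_gt0//.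
apply: (@le_lt_trans _ _ (64 ^+ k)).
  by rewrite lerXn2r ?nnegrE//; lra.
by rewrite ltr_pMl ?exprn_gt0// ltr1n.
Qed.

Lemma bernoulli_le (x : R) n : 0 <= x <= 1 -> 1 - n%:R * x <= (1 - x) ^+ n.
Proof.
move=> /andP[x0 x1]; elim: n => [|n IH]; first by rewrite mul0r subr0 expr0.
rewrite exprS; apply: (@le_trans _ _ ((1 - x) * (1 - n%:R * x))).
  rewrite -natr1; have : 0 <= n%:R * x * x by rewrite !mulr_ge0.
  lra.
by rewrite ler_wpM2l// subr_ge0.
Qed.

Lemma lac_radius_lower k : 1 / 2 <= lac_radius k ^+ (64 ^ k).-1.
Proof.
have /andP[r0 r1] := lac_radius_bounds k.
have r00 : 0 <= lac_radius k by lra.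
have p0 : 0 < 64 ^+ k :> R by rewrite exprn_gt0.
apply: (@le_trans _ _ (lac_radius k ^+ (64 ^ k))); last first.
  by rewrite ler_wiXn2l ?leq_pred// ltW.
have := @bernoulli_le (2 * 64 ^+ k)^-1 (64 ^ k).
rewrite -/(lac_radius k) natrX.
have -> : 64 ^+ k * (2 * 64 ^+ k)^-1 = 1 / 2 :> R by field; rewrite gt_eqF.
move=> H; have {}H : 1 - 1 / 2 <= lac_radius k ^+ (64 ^ k).
  by apply: H; rewrite /lac_radius in r0 r1 *; lra.
lra.
Qed.

(** From 1 - x <= e^-x the left-hand side is at most 1 / e. *)
Lemma lac_radius_upper k : lac_radius k ^+ (2 * 64 ^ k) <= 1 / 2.
Proof.
have /andP[r0 r1] := lac_radius_bounds k.
have p0 : 0 < 64 ^+ k :> R by rewrite exprn_gt0.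
apply: (@le_trans _ _ (expR (- (2 * 64 ^+ k)^-1) ^+ (2 * 64 ^ k))).
  rewrite lerXn2r ?nnegrE ?expR_ge0//; first lra.
  exact: expR_ge1Dx.
rewrite -expRM_natl natrM natrX mulrN mulfV ?gt_eqF ?mulr_gt0//.
rewrite expRN div1r lef_pV2 ?posrE ?expR_gt0//.
by have := @expR_ge1Dx R 1; lra.
Qed.

(** On the circle of radius r_k the coefficients 32^j grow geometrically,
    whereas the powers r_k^(64^j) decay doubly exponentially as soon as j > k,
    because r_k^(2 * 64^k) <= 1 / 2. *)
Lemma lac_decay k i :
  32 ^+ (k + i.+1) * lac_radius k ^+ (64 ^ (k + i.+1)).-1 <=
    (32 ^+ k / 8) / 2 ^+ i.+1.
Proof.
have /andP[r0 r1] := lac_radius_bounds k; set r := lac_radius k in r0 r1 *.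
have r00 : 0 < r by lra.
set N := (64 ^ (k + i.+1))%N.
have N0 : (0 < N)%N by rewrite expn_gt0.
have H1 : r ^+ N.-1 <= 2 * r ^+ N.
  have x0 : 0 <= r ^+ N.-1 by rewrite exprn_ge0// ltW.
  have -> : r ^+ N = r * r ^+ N.-1 by rewrite -exprS prednK.
  by rewrite mulrA ler_peMl//; lra.
have H2 : r ^+ N <= 2 ^- (6 * i.+1 + 4).
  have -> : N = ((2 * 64 ^ k) * (32 * 64 ^ i))%N.
    by rewrite /N expnD expnS; lia.
  rewrite exprM.
  apply: (@le_trans _ _ ((1 / 2) ^+ (32 * 64 ^ i))).
    rewrite lerXn2r ?nnegrE ?exprn_ge0 ?divr_ge0 ?(ltW r00)//.
    exact: lac_radius_upper.
  rewrite div1r -exprVn ler_wiXn2l ?invr_ge0 ?invf_le1 ?ler1n//.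
  by have := @ltn_expl 64 i isT; lia.
rewrite exprD.
apply: (@le_trans _ _ (32 ^+ k * 32 ^+ i.+1 * (2 * 2 ^- (6 * i.+1 + 4)))).
  rewrite ler_wpM2l ?mulr_ge0 ?exprn_ge0//; lra.
rewrite -mulrA -[leRHS]mulrA ler_wpM2l ?exprn_ge0//.
have -> : (6 * i.+1 + 4 = 5 * i.+1 + (i.+1 + 4))%N by lia.
rewrite !exprD exprM (_ : 2 ^+ 5 = 32); last by rewrite !exprS expr0; lra.
rewrite le_eqVlt; apply/orP; left; apply/eqP.
rewrite (_ : 2 ^+ 4 = 16); last by rewrite !exprS expr0; lra.
by field; rewrite !expf_neq0.
Qed.

Lemma lac_dterm_le k i z : cmod z <= lac_radius k ->
  cmod (lac_dterm (k + i.+1) z) <= (32 ^+ k / 8) / 2 ^+ i.+1.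
Proof.
move=> zr; apply: le_trans (lac_decay k i).
rewrite /lac_dterm cmodM cmodC cmodX ger0_norm ?exprn_ge0//.
rewrite ler_wpM2l ?exprn_ge0// lerXn2r// nnegrE ?cmod_ge0//.
exact: le_trans (cmod_ge0 z) zr.
Qed.

Lemma lac_termB_le k i z w :
  cmod z <= lac_radius k -> cmod w <= lac_radius k ->
  cmod (lac_term (k + i.+1) w - lac_term (k + i.+1) z) <=
    (32 ^+ k / 8 * cmod (w - z)) / 2 ^+ i.+1.
Proof.
move=> zr wr; rewrite [leRHS]mulrAC.
apply: le_trans (ler_wpM2r (cmod_ge0 _) (lac_decay k i)).
rewrite /lac_term -mulrBr cmodM cmodC ger0_norm ?invr_ge0 ?exprn_ge0//.
rewrite -lac_coef -!mulrA ler_wpM2l ?invr_ge0 ?exprn_ge0// mulrA.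
exact: cmodXB_le.
Qed.

Definition lac_limit h := forall z, cmod z <= 1 -> forall n,
  cmod (h z - lac_sum n z) <= 2 / 2 ^+ n.

Lemma lac_limit_exists :
  exists2 h, lac_limit h & forall z, ~ cmod z <= 1 -> h z = 0.
Proof.
have /choice[h hP] : forall z, exists l, (cmod z <= 1 -> forall n,
    cmod (l - lac_sum n z) <= 2 / 2 ^+ n) /\ (~ cmod z <= 1 -> l = 0).
  move=> z; have [z1|z1] := pselect (cmod z <= 1); last by exists 0.
  have [|l Hl] := @geometric_limit R (fun n => lac_sum n z) 2.
    by move=> n; rewrite lac_sumS; exact: lac_term_le.
  by exists l.
by exists h => z; have [] := hP z.
Qed.

Section limit.
Variable h : R[i] -> R[i].
Hypothesis hP : lac_limit h.

Lemma lac_limit_continuous : {within @closed_disk R, continuous h}.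
Proof.
apply/within_diskP => z z1 e e0.
have e30 : 0 < e / 3 by rewrite divr_gt0.
have [n Hn] := geometric_small 2 e30.
have [d d0 H] : exists2 d : R, 0 < d & forall v, cmod v <= d ->
    cmod (lac_sum n (z + v) - lac_sum n z) <= e / 3.
  have [d d0 H] := cderiv_lac_sum n z ltr01.
  set L := cmod (lac_dsum n z) in H *.
  have L0 : 0 < L + 1 by rewrite ltr_wpDl// cmod_ge0.
  exists (Num.min d (e / 3 / (L + 1))); first by rewrite lt_min d0 divr_gt0.
  move=> v; rewrite le_min => /andP[/H vd]; rewrite ler_pdivlMr// => vL.
  have := cmodD (lac_sum n (z + v) - lac_sum n z - lac_dsum n z * v)
    (lac_dsum n z * v).
  rewrite subrK cmodM -/L; move: vd vL; lra.
exists d => // w w1 wd.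
have := H _ wd; rewrite subrKC => {}H.
have := hP z1 n; have := hP w1 n.
have := cmodD (h w - lac_sum n w) (lac_sum n w - lac_sum n z).
rewrite addrA subrK.
have := cmodD (h w - lac_sum n z) (lac_sum n z - h z).
rewrite addrA subrK (cmod_distC _ (h z)); lra.
Qed.

(** The tail of the series is Lipschitz on the disk of radius r_k, with a
    constant that tends to 0 as p grows. *)
Lemma lac_limitB_le k p z w :
  cmod z <= lac_radius k -> cmod w <= lac_radius k ->
  cmod ((h w - h z) - (lac_sum (k + p.+1) w - lac_sum (k + p.+1) z)) <=
    (32 ^+ k / 8 * cmod (w - z)) / 2 ^+ p.
Proof.
move=> zr wr; apply: (@le_of_geometric _ _ _ 4) => n.
pose u p := lac_sum (k + p.+1) w - lac_sum (k + p.+1) z.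
have uS q : cmod (u q.+1 - u q) <= (32 ^+ k / 8 * cmod (w - z)) / 2 ^+ q.+1.
  have -> : u q.+1 - u q = lac_term (k + q.+1) w - lac_term (k + q.+1) z.
    by rewrite -!lac_sumS /u !addnS; ring.
  exact: lac_termB_le.
have D := geometric_dist uS (leq_addr n p).
have /andP[_ rk1] := lac_radius_bounds k.
have w1 : cmod w <= 1 by lra.
have z1 : cmod z <= 1 by lra.
set m := (k + (p + n).+1)%N.
have Hw := hP w1 m; have Hz := hP z1 m.
have mn : 2 / 2 ^+ m <= 2 / 2 ^+ n :> R.
  rewrite ler_wpM2l// lef_pV2 ?posrE ?exprn_gt0// ler_weXn2l// ?ler1n//.
  by rewrite /m; lia.
have E : h w - h z - u p =
    (u (p + n)%N - u p) + ((h w - lac_sum m w) - (h z - lac_sum m z)).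
  by rewrite /u -/m; ring.
rewrite -/(u p) E; apply: (le_trans (cmodD _ _)); apply: lerD => //.
apply: (le_trans (cmodD _ _)); rewrite cmodN; lra.
Qed.

(** The derivative is the limit l of the differentiated series, whose terms of
    index > k add up to at most 32^k / 8 where |z| <= r_k.  The difference
    quotients are controlled on the larger disk of radius r_(k+1), which is a
    neighborhood of z even when |z| = r_k. *)
Lemma lac_limit_deriv k z : cmod z <= lac_radius k ->
  exists2 l, cderiv h z l & cmod (l - lac_dsum k.+1 z) <= 32 ^+ k / 8.
Proof.
move=> zr.
have [|l Hl] :=
    @geometric_limit R (fun p => lac_dsum (k + p.+1) z) (32 ^+ k / 8).
  by move=> p /=; rewrite (addnS k p.+1) lac_dsumS; exact: lac_dterm_le.
exists l; last by have := Hl 0%N; rewrite expr0 divr1 addn1.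
move=> e e0.
have rr := lac_radius_incr k.
set K : R := 32 ^+ k.+1 / 8.
have K32 : 32 ^+ k / 8 <= K.
  have : 0 <= 32 ^+ k :> R by exact: exprn_ge0.
  rewrite /K exprS; lra.
have e30 : 0 < e / 3 by rewrite divr_gt0.
have [p Hp] := geometric_small K e30.
set n := (k + p.+2)%N.
have [d d0 H] := cderiv_lac_sum n z e30.
exists (Num.min d (lac_radius k.+1 - lac_radius k)).
  by rewrite lt_min d0 subr_gt0.
move=> v; rewrite le_min => /andP[/H {}H vr].
have zr1 : cmod z <= lac_radius k.+1 by lra.
have zv1 : cmod (z + v) <= lac_radius k.+1 by have := cmodD z v; lra.
have vE : z + v - z = v by rewrite addrC addKr.
have := lac_limitB_le p zr1 zv1; rewrite addSnnS -/n vE -/K => B1.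
have := Hl p.+1; rewrite -/n => B2.
have v0 := cmod_ge0 v.
have B3 : 32 ^+ k / 8 / 2 ^+ p.+1 <= e / 3.
  apply: le_trans Hp; apply: (@le_trans _ _ (K / 2 ^+ p.+1)).
    by rewrite ler_wpM2r// invr_ge0 exprn_ge0.
  rewrite ler_wpM2l ?divr_ge0 ?exprn_ge0// lef_pV2 ?posrE ?exprn_gt0//.
  by rewrite ler_weXn2l// ler1n.
have B1' : K * cmod v / 2 ^+ p <= e / 3 * cmod v by rewrite mulrAC ler_wpM2r.
have B2' : cmod ((l - lac_dsum n z) * v) <= e / 3 * cmod v.
  by rewrite cmodM ler_wpM2r// (le_trans B2).
have -> : h (z + v) - h z - l * v =
  ((h (z + v) - h z) - (lac_sum n (z + v) - lac_sum n z)) +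
  ((lac_sum n (z + v) - lac_sum n z - lac_dsum n z * v) -
   (l - lac_dsum n z) * v) by ring.
apply: (le_trans (cmodD _ _)).
have := cmodD (lac_sum n (z + v) - lac_sum n z - lac_dsum n z * v)
  (- ((l - lac_dsum n z) * v)).
rewrite cmodN; move: B1 B1' B2' H; lra.
Qed.

Lemma lac_limit_derivable z : cmod z < 1 -> derivable h z 1.
Proof.
move=> /lt_lac_radius[k /ltW zk].
by have [l Hl _] := lac_limit_deriv zk; exact: cderiv_derivable Hl.
Qed.

Lemma lac_dsum_le k z : cmod z <= 1 -> cmod (lac_dsum k z) <= 32 ^+ k / 31.
Proof.
move=> z1; elim: k => [|k IH].
  by rewrite /lac_dsum big_ord0 cmod0 divr_ge0// exprn_ge0.
have := cmodD (lac_dsum k.+1 z - lac_dsum k z) (lac_dsum k z).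
rewrite subrK lac_dsumS.
have : cmod (lac_dterm k z) <= 32 ^+ k.
  rewrite /lac_dterm cmodM cmodC cmodX ger0_norm ?exprn_ge0//.
  by rewrite ler_piMr ?exprn_ge0// exprn_ile1// cmod_ge0.
rewrite exprS; lra.
Qed.

(** The k-th term of the derivative has modulus at least 32^k / 2, the earlier
    ones add up to at most 32^k / 31 and the tail to at most 32^k / 8. *)
Lemma lac_limit_derive1_ge k z : cmod z = lac_radius k ->
  32 ^+ k / 8 <= cmod (derive1 h z).
Proof.
move=> zr; have zr' : cmod z <= lac_radius k by rewrite zr.
have [l /cderiv_derive1 -> Hl] := lac_limit_deriv zr'.
have /andP[_ rk1] := lac_radius_bounds k.
have z1 : cmod z <= 1 by lra.
have Hs := lac_dsum_le k z1.
have Ht : 32 ^+ k / 2 <= cmod (lac_dterm k z).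
  rewrite /lac_dterm cmodM cmodC cmodX ger0_norm ?exprn_ge0// zr.
  by rewrite ler_wpM2l ?exprn_ge0//; have := lac_radius_lower k; lra.
have E : lac_dterm k z = (lac_dsum k.+1 z - l) + (l - lac_dsum k z).
  by rewrite -lac_dsumS; ring.
have := cmodD (lac_dsum k.+1 z - l) (l - lac_dsum k z); rewrite -E.
have := cmodD l (- lac_dsum k z); rewrite cmodN.
have : 0 <= 32 ^+ k :> R by exact: exprn_ge0.
rewrite (cmod_distC _ l); lra.
Qed.

End limit.

Lemma derivative_blowup_exists : exists h : disk_algebra R, derivative_blowup h.
Proof.
have [h hP h0] := lac_limit_exists.
have hD : is_disk_algebra h.
  apply/asboolP; split; first exact: lac_limit_continuous.
    by move=> z /open_diskE; exact: lac_limit_derivable.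
  by move=> z nz; apply: h0 => /closed_diskE.
exists (DiskAlgebra hD) => M.
set k := Num.bound (8 * `|M|).
exists (lac_radius k); first by have := lac_radius_bounds k; lra.
move=> z zr; apply: le_trans (lac_limit_derive1_ge hP zr).
have K0 : 0 <= 8 * `|M| by rewrite mulr_ge0.
have : 8 * `|M| < 32 ^+ k.
  by apply: lt_trans (archi_boundP K0) _; rewrite -natrX ltr_nat ltn_expl.
have := ler_norm M; lra.
Qed.

End lacunary.

(** * Density *)

Section density.
Context {R : realType}.
Implicit Types (f g h : disk_algebra R) (z w l : R[i]) (rho : R).

Definition dilate_fun rho f z : R[i] :=
  if cmod z <= 1 then f ((rho%:C)%C * z) else 0.

Lemma cmod_dilate_le rho z : 0 < rho < 1 -> cmod ((rho%:C)%C * z) <= cmod z.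
Proof.
by move=> /andP[r0 r1]; rewrite cmodCM// ler_piMl ?cmod_ge0// ltW.
Qed.

Lemma dilate_fun_cderiv rho f z : 0 < rho < 1 -> cmod z < 1 ->
  cderiv (dilate_fun rho f) z ((rho%:C)%C * derive1 f ((rho%:C)%C * z)).
Proof.
move=> r01 z1 e e0; have rz v := cmod_dilate_le v r01.
have [d d0 H] := disk_cderiv f (le_lt_trans (rz z) z1) e0.
exists (Num.min d (1 - cmod z)); first by rewrite lt_min d0 subr_gt0.
move=> v; rewrite le_min => /andP[vd vz].
have zv : cmod (z + v) <= 1 by have := cmodD z v; lra.
rewrite /dilate_fun zv (ltW z1) mulrDr.
have -> : (rho%:C)%C * derive1 f ((rho%:C)%C * z) * v =
          derive1 f ((rho%:C)%C * z) * ((rho%:C)%C * v) by ring.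
apply: (le_trans (H _ (le_trans (rz v) vd))).
by rewrite ler_pM2l.
Qed.

Lemma dilate_disk_algebra rho f :
  0 < rho < 1 -> is_disk_algebra (dilate_fun rho f).
Proof.
move=> r01; have rz v := cmod_dilate_le v r01.
apply/asboolP; split.
- apply/within_diskP => z z1 e e0.
  have [d d0 H] := disk_unif_continuous f e0; exists d => // w w1 wd.
  rewrite /dilate_fun z1 w1; apply: H.
  + exact: le_trans (rz z) z1.
  + exact: le_trans (rz w) w1.
  + by rewrite -mulrBr (le_trans (rz _)).
- move=> z /open_diskE z1.
  exact: cderiv_derivable (dilate_fun_cderiv f r01 z1).
- move=> z nz; rewrite /dilate_fun; case: ifP => // z1.
  by case: nz; apply/closed_diskE.
Qed.

(** Take g(z) = f(rho z) with rho close to 1: it is close to f by uniform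
    continuity, and g' only involves f' on the disk of radius rho, where
    Cauchy's estimate bounds it. *)
Lemma dilation_approx f (e : R) : 0 < e -> exists g,
  (forall z, cmod z <= 1 -> cmod (f z - g z) <= e) /\
  exists C : R, forall z, cmod z < 1 -> cmod (derive1 g z) <= C.
Proof.
move=> e0; have [d d0 H] := disk_unif_continuous f e0.
set rho := 1 - Num.min d (1 / 2).
have m0 : 0 < Num.min d (1 / 2) by rewrite lt_min d0 divr_gt0.
have m1 : Num.min d (1 / 2) <= 1 / 2 by rewrite ge_min lexx orbT.
have r01 : 0 < rho < 1 by rewrite /rho; lra.
have rd : 1 - rho <= d by rewrite /rho opprB addrC subrK ge_min lexx.
clearbody rho.
have [r0 r1] := andP r01.
have rz v := cmod_dilate_le v r01.
exists (DiskAlgebra (dilate_disk_algebra f r01)); split.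
  move=> z z1; rewrite /= /dilate_fun z1; apply: H => //.
    exact: le_trans (rz z) z1.
  have -> : z - (rho%:C)%C * z = ((1 - rho)%:C)%C * z.
    by rewrite rmorphB rmorph1 mulrBl mul1r.
  have r10 : 0 < 1 - rho by rewrite subr_gt0.
  by rewrite cmodCM//; apply: le_trans rd; rewrite ler_piMr// ltW.
exists (4 / (1 - rho) * disk_norm f) => z z1.
rewrite (cderiv_derive1 (dilate_fun_cderiv f r01 z1)).
apply: (le_trans (cmod_dilate_le _ r01)).
apply: (le_trans (disk_derive1_le f (le_lt_trans (rz z) z1))).
rewrite ler_wpM2r ?disk_norm_ge0// ler_wpM2l//.
have rzr : cmod ((rho%:C)%C * z) <= rho by rewrite cmodCM// ler_piMr// ltW.
by rewrite lef_pV2 ?posrE; lra.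
Qed.

Lemma derivative_blowup_add g h (c : R) : 0 < c -> derivative_blowup h ->
  (exists C : R, forall z, cmod z < 1 -> cmod (derive1 g z) <= C) ->
  derivative_blowup (g + (c%:C)%C *: h).
Proof.
move=> c0 bh [C gC] M; have [r r01 H] := bh ((M + C) / c).
exists r; first exact: r01.
move=> z zr.
have z1 : cmod z < 1 by rewrite zr; case/andP: r01.
have := cderivD (disk_cderiv g z1) (cderivZ (c%:C)%C (disk_cderiv h z1)).
move=> /cderiv_derive1 E.
have -> : derive1 (g + (c%:C)%C *: h) z =
  derive1 g z + (c%:C)%C * derive1 h z by exact: E.
move: (H z zr) (gC z z1); rewrite ler_pdivrMr//.
move: (derive1 g z) (derive1 h z) => a b Hb Ha.
have := cmodD (a + (c%:C)%C * b) (- a).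
rewrite cmodN [X in cmod X <= _](_ : _ = (c%:C)%C * b); last by ring.
rewrite cmodCM//; lra.
Qed.

Lemma dense_unbounded_means : dense (@unbounded_means R).
Proof.
move=> O [f Of]; rewrite openE => /(_ f Of).
move=> /nbhs_ballP[_ /= /complex_gt0[e e0 ->]] fO.
have e30 : 0 < e / 3 by rewrite divr_gt0.
have [g [fg gC]] := dilation_approx f e30.
have [h bh] := @derivative_blowup_exists R.
have h1 : 0 < disk_norm h + 1 by rewrite ltr_wpDl// disk_norm_ge0.
set c := e / 3 / (disk_norm h + 1).
have c0 : 0 < c by rewrite divr_gt0.
have ch : c * disk_norm h <= e / 3.
  by rewrite /c mulrAC ler_pdivrMr// ler_pM2l// lerDl.
exists (g + (c%:C)%C *: h); split; last first.
  exact/derivative_blowup_unbounded/derivative_blowup_add.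
apply: fO; rewrite -ball_normE/= ltcR.
apply: (@le_lt_trans _ _ (e / 3 + e / 3)); last by lra.
apply: disk_norm_le => z /[dup] zD /closed_diskE z1.
have -> : (f - (g + (c%:C)%C *: h)) z = (f z - g z) - (c%:C)%C * h z.
  rewrite -[LHS]/(f z - (g z + (c%:C)%C * h z)); ring.
apply: (le_trans (cmodD _ _)); rewrite cmodN; apply: lerD; first exact: fg.
rewrite cmodCM//; apply: le_trans ch; rewrite ler_pM2l//.
exact: disk_norm_ub.
Qed.

End density.

Theorem theorem3p1 (R : realType) :
  [/\ Gdelta (@unbounded_means R),
      dense (@unbounded_means R),
      @unbounded_means R !=set0
    & exists G : set (disk_algebra R),
        [/\ Gdelta G, dense G
          & forall f, G f -> forall A B : R, A < B ->
              ereal_sup [set (log_plus_mean A B f r)%:E | r in `]0, 1[]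
                = +oo%E]].
Proof.
split.
- exact: Gdelta_unbounded_means.
- exact: dense_unbounded_means.
- have [h /derivative_blowup_unbounded uh] := @derivative_blowup_exists R.
  by exists h.
- exists (@unbounded_means R); split.
  + exact: Gdelta_unbounded_means.
  + exact: dense_unbounded_means.
  + by move=> f uf A B; exact: ereal_sup_means.
Qed.
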